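(* Let $\beta,h,\gamma\ge0$ with $C(\beta,\gamma)<1$, and let $\nu_\star=\nu_\star(\beta,h,\gamma)$ be the unique fixpoint of $T_{\beta,h,\gamma}$. There exists a function $\alpha(\beta,\gamma)$, nondecreasing in each of its two arguments, finite whenever $C(\beta,\gamma)<1$, and not depending on $k,N,f,g$, such that the following holds. For all $k,N\in\mathbb N$ with $k\le N$ and $N\ge\gamma$, every $f:\{0,1\}^k\to\mathbb R$ and every function $g$ which is $L_g$-Lipschitz on $[\min f,\max f]$, $$\Big|\mathbb E\, g\big(\langle f(\sigma_1,\dots,\sigma_k)\rangle\big)-\mathbb E\, g\big(\mathbb E[f(B_1,\dots,B_k)\mid X]\big)\Big|\le \alpha(\beta,\gamma)\,\|f\|_\infty\,L_g\,\frac{k^3}{N},$$ where $X=(X_1,\dots,X_k)$ are i.i.d. with law $\nu_\star$ and, conditionally on $X$, $B_1,\dots,B_k$ are independent with $B_i\sim$ Bernoulli$(X_i)$.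
   Context: Model: for parameters $\beta,h,\gamma\ge0$ and $N\in\mathbb N$ with $N\ge\gamma$, let $\Sigma_N=\{0,1\}^N$ and let $(g_{ij})_{1\le i<j\le N}$ be independent Bernoulli$(\gamma/N)$ random variables with expectation $\mathbb E$. The Hamiltonian is $H_N(\sigma)=h\sum_{i\le N}\sigma_i-\beta\sum_{1\le i<j\le N}g_{ij}\sigma_i\sigma_j$, the (random) Gibbs measure is $\mathcal G_N(\sigma)=e^{H_N(\sigma)}/Z_N$ with $Z_N=\sum_{\sigma\in\Sigma_N}e^{H_N(\sigma)}$, and $\langle\cdot\rangle$ denotes expectation with respect to $\mathcal G_N$. $\|f\|_\infty=\max|f|$. $C(\beta,\gamma):=7(\gamma+\gamma^3)(e^{2\beta}-1)\exp(\gamma(e^{2\beta}-1))$. For $x\in[0,1]^{\mathbb N}$, $\langle\cdot\rangle_x$ is the product measure on spins with $\langle\sigma_i\rangle_x=x_i$; for a probability measure $\nu$ on $[0,1]$, $T_{\beta,h,\gamma}(\nu)$ is the law of $\big(1+\langle \exp(h-\beta\sum_{i\le r}\sigma_i)\rangle_X^{-1}\big)^{-1}$, where $X=(X_i)$ is i.i.d. $\nu$ and $r\sim$ Poisson$(\gamma)$ is independent of $X$. When $C(\beta,\gamma)<1$, $T_{\beta,h,\gamma}$ has a unique fixpoint $\nu_\star(\beta,h,\gamma)$. *)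

(* Defs.v *)
From HB Require Import structures.
From mathcomp Require Import all_boot all_order all_algebra.
From mathcomp Require Import all_classical all_reals all_analysis.
Set Implicit Arguments. Unset Strict Implicit. Unset Printing Implicit Defensive.
Import Order.TTheory GRing.Theory Num.Theory.
Local Open Scope classical_set_scope.
Local Open Scope ring_scope.

Section Defs.
Variable R : realType.

Definition Cbg (b c : R) : R :=
  7 * (c + c ^+ 3) * (expR (2 * b) - 1) * expR (c * (expR (2 * b) - 1)).

Definition bern_w (x : R) (b : bool) : R := if b then x else 1 - x.

Definition prodE (n : nat) (x : n.-tuple R) (F : n.-tuple bool -> R) : R :=
  \sum_(s : n.-tuple bool) (\prod_(i < n) bern_w (tnth x i) (tnth s i)) * F s.

Definition Phi (b h : R) (r : nat) (x : r.-tuple R) : R :=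
  (1 + (prodE x (fun s => expR (h - b * \sum_(i < r) (tnth s i)%:R)))^-1)^-1.

Definition pois (c : R) (r : nat) : R := expR (- c) * c ^+ r / (r`!)%:R.

(** iterated integral of F(X_1,...,X_n) with X_i i.i.d. of law nu
    (nu is concentrated on [0,1]). *)
Fixpoint iint (nu : {measure set R -> \bar R}) (n : nat)
  : (n.-tuple R -> \bar R) -> \bar R :=
  match n return (n.-tuple R -> \bar R) -> \bar R with
  | 0 => fun F => F [tuple]
  | n'.+1 => fun F =>
      (\int[nu]_(x in `[0%R, 1%R]%classic) iint nu (fun t => F (cons_tuple x t)))%E
  end.

Definition Tmap (b h c : R) (nu : {measure set R -> \bar R}) (A : set R)
  : \bar R :=
  (\sum_(0 <= r <oo) ((pois c r)%:E * @iint nu r (fun x : r.-tuple R => (\1_A (Phi b h x))%:E)))%E.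

Definition is_T_fixpoint (b h c : R) (nu : probability R R) : Prop :=
  nu `[0%R, 1%R]%classic = 1%E /\
  forall A : set R, measurable A -> nu A = Tmap b h c nu A.

Definition edge (N : nat) := {p : 'I_N * 'I_N | (p.1 < p.2)%N}.

Definition Ham (N : nat) (b h : R) (G : {ffun edge N -> bool})
  (s : N.-tuple bool) : R :=
  h * \sum_(i < N) (tnth s i)%:R
  - b * \sum_(e : edge N) (G e)%:R * (tnth s (val e).1)%:R * (tnth s (val e).2)%:R.

Definition gibbs (N : nat) (b h : R) (G : {ffun edge N -> bool})
  (F : N.-tuple bool -> R) : R :=
  (\sum_(s : N.-tuple bool) expR (Ham b h G s) * F s)
  / (\sum_(s : N.-tuple bool) expR (Ham b h G s)).

Definition Egraph (N : nat) (c : R) (Fg : {ffun edge N -> bool} -> R) : R :=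
  \sum_(G : {ffun edge N -> bool})
     (\prod_(e : edge N) (if G e then c / N%:R else 1 - c / N%:R)) * Fg G.

Definition firstk (k N : nat) (Hk : (k <= N)%N) (s : N.-tuple bool)
  : k.-tuple bool := [tuple tnth s (widen_ord Hk i) | i < k].

Definition fdefault (k : nat) : k.-tuple bool := [tuple of nseq k false].
Definition fmin (k : nat) (f : k.-tuple bool -> R) : R :=
  \big[Num.min/f (fdefault k)]_(s : k.-tuple bool) f s.
Definition fmax (k : nat) (f : k.-tuple bool -> R) : R :=
  \big[Num.max/f (fdefault k)]_(s : k.-tuple bool) f s.
Definition supnorm (k : nat) (f : k.-tuple bool -> R) : R :=
  \big[Num.max/0]_(s : k.-tuple bool) `|f s|.

Definition lipschitz_itv (g : R -> R) (L a b : R) : Prop :=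
  forall x y, a <= x <= b -> a <= y <= b -> `|g x - g y| <= L * `|x - y|.

End Defs.

(* Main.v *)
(* Write the Gibbs measure as a hard-core type model with site weights lam_i (lam_i = 0 deletes
   the vertex i) and let m_v be the occupation probability of v. Conditioning on v gives
   m_v = phi (m_w, w ~ v), up to the dependence of the neighbours on one another after v is
   deleted. That dependence is controlled by an influence function, a sum over self-avoiding
   paths whose expectation on the sparse random graph is O(1/N) when C(beta,gamma) < 1; the same
   influences show that the first k spins are nearly independent given their means.
   For the joint law of the means m_v one exposes one vertex at a time: v is replaced by the set of
   its neighbours in what is left of the graph, whose size is binomial, while on the limit side the
   fixpoint equation replaces a nu-distributed variable by phi of a Poisson number of
   nu-distributed ones. A test function that is a-Lipschitz in v becomes aL-Lipschitz in the new
   vertices, so after k steps one starts again with the new vertices and Lipschitz constant aL; as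
   L gamma < 1/14 the errors, of order 1/N each, sum up geometrically. Every comparison is made as
   an inequality valid for all test functions, and then applied to F and -F. *)
Require Import Defs.
From mathcomp Require Import all_boot all_order all_algebra.
From mathcomp Require Import all_classical all_reals all_analysis.
From mathcomp Require Import measurable_realfun zify ring lra.
Set Implicit Arguments. Unset Strict Implicit. Unset Printing Implicit Defensive.
Import Order.TTheory GRing.Theory Num.Theory numFieldNormedType.Exports.
Local Open Scope ring_scope.

(** * Hard-core type weights and their split at one site *)

Section HardCore.
Variables (R : realType) (V : finType) (t : R).
Hypotheses (t_gt0 : 0 < t) (t_le1 : t <= 1).
Implicit Types (g : V -> V -> bool) (lam : V -> R) (s : {ffun V -> bool}).

(** Deleting a vertex, or conditioning on its spin, changes the site weights only and never the
    vertex type, so the inductions over shrinking graphs stay inside one [finType]. All inequalities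
    are driven by a single number, the Lipschitz constant L of [phi] in each argument. L gamma
    controls the sums over paths; L gamma^2 enters because the error grows quadratically with the
    number of vertices in play, so that second moments of neighbourhood sizes appear. The obstacle
    on the limit side is that the fixpoint equation only gives measures of sets, through iterated
    integrals of indicators along [Phi]. Their measurability is avoided: for nonnegative functions
    the integral is superadditive in any case, and this yields an upper bound for the nu-integral of
    a Lipschitz function. That is where the one-sided form of the comparison comes from. The error
    is carried as an explicit polynomial in the numbers of old, new and deleted vertices, quadratic
    in the number of new ones, so that averaging it takes two binomial moments and both steps of the
    recursion become polynomial inequalities. *)

Definition upd s v b : {ffun V -> bool} := [ffun u => if u == v then b else s u].

(* Each edge occurs twice in the double product, so the interaction per edge is [t ^+ 2]. *)
Definition wt g lam s : R :=
  \prod_i (if s i then lam i else 1) *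
  \prod_i \prod_j (if [&& s i, s j & g i j] then t else 1).

Definition wsum g lam (F : {ffun V -> bool} -> R) : R := \sum_s wt g lam s * F s.

Definition avg g lam F : R := wsum g lam F / wsum g lam (fun=> 1).

Definition occ g lam v : R := avg g lam (fun s => (s v)%:R).

Definition zap v lam : V -> R := fun u => if u == v then 0 else lam u.

(** The weights seen by the other sites once [v] is occupied: an occupied neighbour pays [t ^+ 2],
    and [v], being accounted for, is removed. *)
Definition scl g v lam : V -> R :=
  fun u => if u == v then 0 else if g v u then t ^+ 2 * lam u else lam u.

Lemma updE s v b u : upd s v b u = if u == v then b else s u.
Proof. by rewrite ffunE. Qed.
#[global] Opaque upd.

Lemma upd_upd s v b b' : upd (upd s v b) v b' = upd s v b'.
Proof. by apply/ffunP => u; rewrite !updE; case: eqP. Qed.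

Lemma wt_zap g lam s v : wt g (zap v lam) s = if s v then 0 else wt g lam s.
Proof.
rewrite /wt; case: ifP => sv.
  by rewrite (bigD1 v)//= sv /zap eqxx !mul0r.
congr (_ * _); apply: eq_bigr => i _; rewrite /zap; case: eqP => // ->.
by rewrite sv.
Qed.

(** Row [v] and column [v] of the double product each give one factor [t] per occupied neighbour of
    [v]. *)
Lemma wt_upd_true g lam s v : (forall i j, g i j = g j i) -> (forall i, g i i = false) ->
  s v = false -> wt g lam (upd s v true) = lam v * wt g (scl g v lam) s.
Proof.
move=> gC gI sv; rewrite /wt.
rewrite (bigD1 v)//= updE eqxx -mulrA; congr (_ * _).
rewrite [in RHS](bigD1 v)//= sv mul1r.
have -> : \prod_i \prod_j (if [&& upd s v true i, upd s v true j & g i j] then t else 1) =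
  \prod_(i | i != v) (if s i && g v i then t ^+ 2 else 1) *
  \prod_i \prod_j (if [&& s i, s j & g i j] then t else 1).
  rewrite (bigD1 v)//= [X in _ = _ * X](bigD1 v)//=.
  rewrite [X in _ = _ * (X * _)]big1 ?mul1r; last by move=> j _; rewrite sv.
  have -> : \prod_j (if [&& upd s v true v, upd s v true j & g v j] then t else 1) =
    \prod_(i | i != v) (if s i && g v i then t else 1).
    rewrite (bigD1 v)//= !updE eqxx gI mul1r; apply: eq_bigr => j jv.
    by rewrite !updE (negbTE jv).
  have -> : \prod_(i | i != v) \prod_j (if [&& upd s v true i, upd s v true j & g i j] then t else 1) =
    \prod_(i | i != v) (if s i && g v i then t else 1) *
    \prod_(i | i != v) \prod_j (if [&& s i, s j & g i j] then t else 1).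
    rewrite -big_split/=; apply: eq_bigr => i iv.
    rewrite (bigD1 v)//= [X in _ = _ * X](bigD1 v)//= sv andbF mul1r.
    rewrite !updE eqxx (negbTE iv)/= gC; congr (_ * _); apply: eq_bigr => j jv.
    by rewrite !updE (negbTE jv).
  rewrite mulrA; congr (_ * _); rewrite -big_split/=; apply: eq_bigr => i iv.
  by case: ifP; rewrite ?mulr1 ?expr2.
rewrite mulrA; congr (_ * _); rewrite -big_split/=; apply: eq_bigr => i iv.
rewrite updE /scl (negbTE iv); case: (s i) => /=; last by rewrite mulr1.
by case: (g v i); rewrite ?mulr1// mulrC.
Qed.

Lemma sum_upd (F : {ffun V -> bool} -> R) v b :
  \sum_(s : {ffun V -> bool} | s v == b) F s = \sum_(s : {ffun V -> bool} | s v != b) F (upd s v b).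
Proof.
rewrite (reindex_onto (fun s => upd s v b) (fun s => upd s v (~~ b)))/=; last first.
  by move=> s /eqP <-; apply/ffunP => u; rewrite !updE; case: eqP => [->|].
apply: eq_bigl => s; rewrite updE eqxx eqxx /=; apply/eqP/idP => [<-|].
  by rewrite !updE eqxx; case: b.
move=> sb; apply/ffunP => u; rewrite !updE; case: eqP => // ->.
by move: sb; case: (s v); case: b.
Qed.

(** Under a product of Bernoulli laws, overwriting one coordinate by a fresh Bernoulli variable
    preserves expectations. It serves with [V] the set of potential edges of the random graph. *)
Lemma sum_resample (p : R) v (F : {ffun V -> bool} -> R) :
  let E F' := \sum_(s : {ffun V -> bool}) (\prod_i (if s i then p else 1 - p)) * F' s in
  E F = p * E (fun s => F (upd s v true)) + (1 - p) * E (fun s => F (upd s v false)).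
Proof.
move=> E.
have Ecase F' : E F' = \sum_(s : {ffun V -> bool} | s v != true)
    (\prod_(i | i != v) (if s i then p else 1 - p)) *
      (p * F' (upd s v true) + (1 - p) * F' (upd s v false)).
  rewrite /E (bigID (fun s : {ffun V -> bool} => s v == true))/=.
  rewrite sum_upd -big_split/=; apply: eq_bigr => s sv.
  have -> : upd s v false = s.
    by apply/ffunP => i; rewrite updE; case: eqP => // ->; move: sv; case: (s v).
  rewrite (bigD1 v)//= updE eqxx [X in _ + X * _](bigD1 v)//=.
  move: sv; case: (s v) => //= _.
  rewrite (eq_bigr (fun i => if s i then p else 1 - p)); first by ring.
  by move=> i iv; rewrite updE (negbTE iv).
rewrite !Ecase !mulr_sumr -big_split/=; apply: eq_bigr => s _.
by rewrite !upd_upd; ring.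
Qed.

(** Splitting by the value of [s v] shows that the partition function is affine in the weight of
    [v]; [occE], [occC] and [avg_split] all come from this. *)
Lemma wsum_split g lam v F : (forall i j, g i j = g j i) -> (forall i, g i i = false) ->
  wsum g lam F = wsum g (zap v lam) F +
    lam v * wsum g (scl g v lam) (fun s => F (upd s v true)).
Proof.
move=> gC gI; rewrite /wsum.
have E lam' F' : lam' v = 0 -> \sum_s wt g lam' s * F' s =
    \sum_(s : {ffun V -> bool} | s v != true) wt g lam' s * F' s.
  move=> l0; rewrite [LHS](bigID (fun s : {ffun V -> bool} => s v == true))/=.
  rewrite big1 ?add0r// => s /eqP sv; rewrite /wt (bigD1 v)//= sv l0.
  by rewrite !mul0r.
rewrite (E (zap v lam)) ?(E (scl g v lam)) ?/zap ?/scl ?eqxx//.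
rewrite (bigID (fun s : {ffun V -> bool} => s v == true))/= addrC; congr (_ + _).
  by apply: eq_bigr => s; rewrite -/(zap v lam) wt_zap => /negbTE; case: (s v).
rewrite sum_upd mulr_sumr; apply: eq_bigr => s; rewrite eqb_id => /negbTE sv.
by rewrite wt_upd_true// mulrA.
Qed.

End HardCore.

(** * Occupation probabilities and their exact recursion through [phi] *)

Section Occupation.
Variables (R : realType) (V : finType) (t : R) (g : V -> V -> bool).
Hypotheses (t_gt0 : 0 < t) (gC : forall i j, g i j = g j i) (gI : forall i, g i i = false).
Implicit Types (lam : V -> R) (v w : V) (F : {ffun V -> bool} -> R).

Local Notation Z lam := (wsum t g lam (fun=> 1)).

Lemma wt_ge0 lam s : (forall v, 0 <= lam v) -> 0 <= wt t g lam s.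
Proof.
move=> lam0; apply: mulr_ge0; apply: prodr_ge0 => i _; first by case: ifP.
by apply: prodr_ge0 => j _; case: ifP => // _; exact: ltW.
Qed.

Lemma wsum_gt0 lam : (forall v, 0 <= lam v) -> 0 < Z lam.
Proof.
move=> lam0; rewrite /wsum (bigD1 [ffun=> false])//= ltr_pwDl//.
  rewrite mulr1 /wt big1 => [|i _]; last by rewrite ffunE.
  by rewrite mul1r big1// => i _; rewrite big1// => j _; rewrite ffunE.
by apply: sumr_ge0 => s _; rewrite mulr1; exact: wt_ge0.
Qed.

Lemma zap_ge0 lam v : (forall v, 0 <= lam v) -> forall u, 0 <= zap v lam u.
Proof. by move=> lam0 u; rewrite /zap; case: ifP. Qed.

Lemma scl_ge0 lam v : (forall v, 0 <= lam v) -> forall u, 0 <= scl t g v lam u.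
Proof.
move=> lam0 u; rewrite /scl; case: ifP => // _; case: ifP => // _.
by rewrite mulr_ge0// sqr_ge0.
Qed.

Lemma occE lam v : occ t g lam v = lam v * Z (scl t g v lam) / Z lam.
Proof.
rewrite /occ /avg (wsum_split _ _ v)//; congr (_ / _).
rewrite [X in X + _]big1 ?add0r => [|s _]; last first.
  by rewrite wt_zap; case: ifP; rewrite ?mul0r// mulr0.
by congr (_ * _); apply: eq_bigr => s _; rewrite updE eqxx.
Qed.

Lemma occC lam v : (forall v, 0 <= lam v) -> 1 - occ t g lam v = Z (zap v lam) / Z lam.
Proof.
move=> lam0; have Z0 := wsum_gt0 lam0.
rewrite occE -{1}(divff (lt0r_neq0 Z0)) -mulrBl; congr (_ / _).
by rewrite {1}(wsum_split _ _ v)// addrK.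
Qed.

Lemma occ_ge0 lam v : (forall v, 0 <= lam v) -> 0 <= occ t g lam v.
Proof.
move=> lam0; rewrite occE divr_ge0 ?mulr_ge0// ltW ?wsum_gt0//.
exact: scl_ge0.
Qed.

Lemma occ_le1 lam v : (forall v, 0 <= lam v) -> occ t g lam v <= 1.
Proof.
move=> lam0; rewrite -subr_ge0 occC// divr_ge0// ltW ?wsum_gt0//.
exact: zap_ge0.
Qed.

(** Law of total expectation: given that [v] is occupied or empty, the measure is again of hard-core
    type, with weights [scl] or [zap]. *)
Lemma avg_split lam v F : (forall v, 0 <= lam v) ->
  avg t g lam F = occ t g lam v * avg t g (scl t g v lam) (fun s => F (upd s v true)) +
    (1 - occ t g lam v) * avg t g (zap v lam) F.
Proof.
move=> lam0; rewrite occC// occE {1}/avg (wsum_split _ _ v)// mulrDl /avg.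
have := wsum_gt0 (scl_ge0 v lam0); have := wsum_gt0 (zap_ge0 v lam0).
move=> /lt0r_neq0 z1 /lt0r_neq0 z2; rewrite addrC.
have z3 := lt0r_neq0 (wsum_gt0 lam0).
by congr (_ + _); field; rewrite z3 ?z1 ?z2.
Qed.

Definition scm (l : seq V) lam : V -> R := fun u => if u \in l then t ^+ 2 * lam u else lam u.

Lemma scm_ge0 l lam : (forall v, 0 <= lam v) -> forall u, 0 <= scm l lam u.
Proof. by move=> lam0 u; rewrite /scm; case: ifP => // _; rewrite mulr_ge0 ?sqr_ge0. Qed.

(** The partition function is affine in the weight of [w], and the part proportional to that weight
    is the fraction [occ] of the whole. *)
Lemma wsum_scm1 lam lam' w : (forall v, 0 <= lam v) -> lam' w = t ^+ 2 * lam w ->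
  (forall u, u != w -> lam' u = lam u) ->
  Z lam' = Z lam * (1 - (1 - t ^+ 2) * occ t g lam w).
Proof.
move=> lam0 e1 e2; have Z0 := lt0r_neq0 (wsum_gt0 lam0).
rewrite occE (wsum_split _ _ w)// e1.
have -> : zap w lam' = zap w lam.
  by apply/funext => u; rewrite /zap; case: eqP => // /eqP /e2.
have -> : scl t g w lam' = scl t g w lam.
  by apply/funext => u; rewrite /scl; case: eqP => // /eqP /e2 ->.
rewrite mulrBr mulr1 [X in _ - X]mulrCA [X in _ - _ * X]mulrC divfK//.
by rewrite (@wsum_split _ _ t g lam w)//; ring.
Qed.

(** Each site is measured after the weights of the later ones have been scaled. With this order the
    product in [wsum_scm] telescopes exactly, however the sites depend on one another. *)
Fixpoint pocc (l : seq V) lam : seq R :=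
  if l is w :: l' then occ t g (scm l' lam) w :: pocc l' lam else [::].

Definition odds (a : R) (ms : seq R) : R := a * \prod_(m <- ms) (1 - (1 - t ^+ 2) * m).

Definition phi (a : R) (ms : seq R) : R := odds a ms / (1 + odds a ms).

Lemma wsum_scm l lam : (forall v, 0 <= lam v) -> uniq l ->
  Z (scm l lam) = Z lam * \prod_(m <- pocc l lam) (1 - (1 - t ^+ 2) * m).
Proof.
move=> lam0; elim: l => [|w l IH] /=; first by rewrite big_nil mulr1.
case/andP => wl /IH {}IH; rewrite big_cons mulrCA -IH mulrC.
apply: wsum_scm1 => [u||u uw]; first exact: scm_ge0.
  by rewrite /scm mem_head (negbTE wl).
by rewrite /scm inE (negbTE uw).
Qed.

Definition nb (A : seq V) v := [seq w <- A | g v w].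

(** The ratio of occupied to empty weight at [v] is [odds]. This is exact even in the presence of
    cycles, because the dependence between the neighbours is kept inside [pocc]. *)
Lemma occ_phi A lam v : (forall v, 0 <= lam v) -> uniq A -> (forall w, w \notin A -> lam w = 0) ->
  occ t g lam v = phi (lam v) (pocc (nb A v) (zap v lam)).
Proof.
move=> lam0 uA sA; rewrite occE (@wsum_split _ _ t g lam v)// /phi /odds.
have -> : scl t g v lam = scm (nb A v) (zap v lam).
  apply/funext => u; rewrite /scl /scm /zap mem_filter.
  case: eqP => [->|uv]; first by rewrite gI.
  by case: (boolP (u \in A)) => uA'; rewrite ?andbT// andbF sA//; case: ifP; rewrite ?mulr0.
rewrite wsum_scm ?filter_uniq//; last exact: zap_ge0.
have := lt0r_neq0 (wsum_gt0 (zap_ge0 v lam0)).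
set z := Z (zap v lam); set P := \prod_(_ <- _) _ => z0.
have -> : z + lam v * (z * P) = z * (1 + lam v * P) by ring.
by rewrite mulrCA -mulf_div divff// mul1r.
Qed.

End Occupation.

Definition in01 (R : realType) (x : R) := 0 <= x <= 1.

(** Each coordinate has its own Lipschitz constant: entries already replaced will carry an extra
    factor [lipc t]. *)
Fixpoint wdist (R : realType) (w x y : seq R) : R :=
  match w, x, y with
  | a :: w', b :: x', c :: y' => a * `|b - c| + wdist w' x' y'
  | _, _, _ => 0
  end.

(** * Influence of one site on another along self-avoiding paths *)

Section Influence.
Variables (R : realType) (V : finType) (t : R) (g : V -> V -> bool).
Hypotheses (t_gt0 : 0 < t) (t_le1 : t <= 1).
Hypotheses (gC : forall i j, g i j = g j i) (gI : forall i, g i i = false).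
Implicit Types (lam : V -> R) (v w : V) (A : seq V).

Definition lipc : R := (1 - t ^+ 2) / t ^+ 2.

Lemma lipc_ge0 : 0 <= lipc.
Proof. by rewrite divr_ge0 ?sqr_ge0// subr_ge0 exprn_ile1// ltW. Qed.

Lemma odds_factor (m : R) : in01 m -> t ^+ 2 <= 1 - (1 - t ^+ 2) * m <= 1.
Proof.
case/andP=> m0 m1; have q0 : 0 < t ^+ 2 by rewrite exprn_gt0.
have q1 : t ^+ 2 <= 1 by rewrite exprn_ile1// ltW.
move: (t ^+ 2) q0 q1 => q q0 q1; nra.
Qed.

Lemma odds_prod (ms : seq R) : all (@in01 R) ms ->
  0 <= \prod_(m <- ms) (1 - (1 - t ^+ 2) * m).
Proof.
move=> h; rewrite big_seq; apply: prodr_ge0 => m /(allP h) /odds_factor /andP[+ _].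
by apply: le_trans; rewrite exprn_ge0// ltW.
Qed.

Lemma odds_ge0 (a : R) ms : 0 <= a -> all (@in01 R) ms -> 0 <= odds t a ms.
Proof. by move=> a0 h; rewrite mulr_ge0// odds_prod. Qed.

Lemma phi01 (a : R) ms : 0 <= a -> all (@in01 R) ms -> in01 (phi t a ms).
Proof.
move=> a0 /(odds_ge0 a0); rewrite /phi /in01; set x := odds _ _ _ => x0.
have x1 : 0 < 1 + x by rewrite ltr_pwDl.
by rewrite divr_ge0 ?(ltW x1)//= ler_pdivrMr// mul1r lerDr.
Qed.

(** The difference quotient is [a / ((1 + a * x) * (1 + a * y))], and [a * q <= a * x] is below the
    denominator. The bound is free of [a], which can therefore absorb further factors. *)
Lemma ratio_lip (q a x y : R) : 0 < q -> q <= 1 -> 0 <= a -> q <= x -> q <= y ->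
  `|a * x / (1 + a * x) - a * y / (1 + a * y)| <= `|x - y| / q.
Proof.
move=> q0 q1 a0 qx qy.
have ax : 0 <= a * x by rewrite mulr_ge0// (le_trans (ltW q0)).
have ay : 0 <= a * y by rewrite mulr_ge0// (le_trans (ltW q0)).
have ax1 : 0 < 1 + a * x by rewrite ltr_pwDl.
have ay1 : 0 < 1 + a * y by rewrite ltr_pwDl.
have -> : a * x / (1 + a * x) - a * y / (1 + a * y) =
  (x - y) * (a / ((1 + a * x) * (1 + a * y))).
  by field; rewrite !gt_eqF.
rewrite normrM ler_wpM2l// ger0_norm; last by rewrite divr_ge0// mulr_ge0 ?ltW.
rewrite ler_pdivrMr ?mulr_gt0// -ler_pdivrMl ?invr_gt0// invrK mulrC.
apply: (@le_trans _ _ (a * x)); first by rewrite ler_wpM2l.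
by nra.
Qed.

Lemma phi_cons a m ms : phi t a (m :: ms) = phi t (a * (1 - (1 - t ^+ 2) * m)) ms.
Proof. by rewrite /phi /odds big_cons !mulrA. Qed.

(** Arguments change one at a time, the factors of the others being absorbed into [a]. Changing a
    mean by e moves its factor by (1 - t^2) e, and factors are at least t^2; the quotient is
    [lipc]. *)
Lemma phi_lip (a : R) (x y : seq R) : 0 <= a -> size x = size y ->
  all (@in01 R) x -> all (@in01 R) y ->
  `|phi t a x - phi t a y| <= wdist (nseq (size x) lipc) x y.
Proof.
elim: x y a => [|b x IH] [|c y] a a0 //= => [_ _ _|[sxy] /andP[b01 x01] /andP[c01 y01]].
  by rewrite subrr normr0.
have [fb1 fb2] := andP (odds_factor b01); have [fc1 fc2] := andP (odds_factor c01).
have q0 : 0 < t ^+ 2 by rewrite exprn_gt0.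
have q1 : t ^+ 2 <= 1 by rewrite exprn_ile1// ltW.
have ab0 : 0 <= a * (1 - (1 - t ^+ 2) * b) by rewrite mulr_ge0// (le_trans (ltW q0)).
rewrite !phi_cons.
apply: le_trans (ler_distD (phi t (a * (1 - (1 - t ^+ 2) * b)) y) _ _) _.
rewrite addrC lerD//; last exact: IH.
have := @ratio_lip (t ^+ 2) (a * \prod_(m <- y) (1 - (1 - t ^+ 2) * m)) _ _ q0 q1 _ fb1 fc1.
rewrite /phi /odds ![a * _ * \prod_(_ <- _) _]mulrAC => /(_ _)/le_trans; apply.
  by rewrite mulr_ge0// odds_prod.
have -> : 1 - (1 - t ^+ 2) * b - (1 - (1 - t ^+ 2) * c) = (1 - t ^+ 2) * (c - b) by ring.
by rewrite normrM ger0_norm ?subr_ge0// distrC /lipc mulrAC.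
Qed.

(* Sum over the self-avoiding paths from [v] to [u] inside [A]; [n] is fuel, enough if [size A <= n]. *)
Fixpoint infl (n : nat) A v u : R :=
  if n is n'.+1 then
    let A' := [seq w <- A | w != v] in
    \sum_(w <- A') lipc * (g v w)%:R * ((w == u)%:R + infl n' A' w u)
  else 0.

Lemma infl_ge0 n A v u : 0 <= infl n A v u.
Proof.
elim: n A v => //= n IH A v; apply: sumr_ge0 => w _.
by rewrite mulr_ge0 ?addr_ge0// mulr_ge0// lipc_ge0.
Qed.

Lemma size_pocc l lam : size (pocc t g l lam) = size l.
Proof. by elim: l => //= w l ->. Qed.

Lemma pocc01 l lam : (forall v, 0 <= lam v) -> all (@in01 R) (pocc t g l lam).
Proof.
move=> lam0; elim: l => //= w l ->; rewrite andbT /in01 occ_ge0 ?occ_le1//; exact: scm_ge0.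
Qed.

Lemma mem_size_filter A v n : v \in A -> (size A <= n.+1)%N -> (size [seq w <- A | w != v] <= n)%N.
Proof.
rewrite -has_pred1 has_count => vA; rewrite -(count_predC (pred1 v) A) size_filter => h; rewrite -ltnS.
by apply: leq_trans h; rewrite -addn1 addnC leq_add2r.
Qed.

(** Induction along [occ_phi]: the weight at [u] acts on [v] only through the neighbours [w] of [v],
    in the graph without [v]. If [w] is [u] the trivial bound 1 is paid, which is the indicator in
    [infl]. The weights are general because [pocc] scales those of the other neighbours. *)
Lemma infl_occ n A lam lam' v u : (size A <= n)%N -> uniq A -> v \in A ->
  (forall w, 0 <= lam w) -> (forall w, 0 <= lam' w) ->
  (forall w, w \notin A -> lam w = 0) -> (forall w, w \notin A -> lam' w = 0) ->
  (forall w, w != u -> lam w = lam' w) -> u != v ->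
  `|occ t g lam v - occ t g lam' v| <= infl n A v u.
Proof.
elim: n A lam lam' v => [|n IH] A lam lam' v sA uA vA l0 l0' sl sl' e uv.
  by case: A sA vA {uA sl sl'}.
set A' := [seq w <- A | w != v].
have uA' : uniq A' by rewrite filter_uniq.
have sA' : (size A' <= n)%N by exact: mem_size_filter.
have supp lm : (forall w, w \notin A -> lm w = 0) -> forall w, w \notin A' -> zap v lm w = 0.
  move=> h w; rewrite mem_filter /zap negb_and negbK; case: eqP => //= _; exact: h.
have nbA : nb g A v = nb g A' v.
  rewrite /nb /A' -filter_predI; apply: eq_filter => w /=.
  by case: eqP => [->|]; rewrite ?gI ?andbT.
rewrite !(@occ_phi _ _ t g _ _ _ A) // e 1?eq_sym// nbA.
apply: le_trans (phi_lip (l0' v) _ _ _) _; rewrite ?size_pocc//.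
- by apply: pocc01 => w; exact: zap_ge0.
- by apply: pocc01 => w; exact: zap_ge0.
have -> : infl n.+1 A v u = \sum_(w <- nb g A' v) lipc * ((w == u)%:R + infl n A' w u).
  rewrite /= -/A' /nb [RHS]big_filter [RHS]big_mkcond; apply: eq_bigr => w _ /=.
  by case: (g v w); rewrite ?mulr1// mulr0 mul0r.
have : uniq (nb g A' v) by rewrite filter_uniq.
have : {subset nb g A' v <= A'} by move=> w; rewrite mem_filter => /andP[].
elim: (nb g A' v) => [|w l IHl] sub /=; first by rewrite big_nil.
case/andP=> wl ul; rewrite big_cons lerD//; last first.
  by apply: IHl => // z zl; apply: sub; rewrite inE zl orbT.
have wA' : w \in A' by apply: sub; rewrite mem_head.
have z0 lm : (forall w, 0 <= lm w) -> forall w, 0 <= scm t l (zap v lm) w.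
  by move=> h; apply: scm_ge0 => ?; exact: zap_ge0.
have z1 lm : (forall w, w \notin A -> lm w = 0) -> forall w, w \notin A' -> scm t l (zap v lm) w = 0.
  by move=> h x xA; rewrite /scm supp// mulr0 if_same.
rewrite ler_wpM2l ?lipc_ge0//; case: (eqVneq w u) => [wu|wu].
  rewrite (@le_trans _ _ 1) ?lerDl ?infl_ge0//.
  have := occ_ge0 t_gt0 gC gI w (z0 _ l0); have := occ_le1 t_gt0 gC gI w (z0 _ l0).
  have := occ_ge0 t_gt0 gC gI w (z0 _ l0'); have := occ_le1 t_gt0 gC gI w (z0 _ l0').
  by rewrite ler_norml; lra.
rewrite add0r; apply: IH; rewrite 1?eq_sym//.
- exact: z0.
- exact: z0.
- exact: z1.
- exact: z1.
by move=> x xu; rewrite /scm /zap e.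
Qed.

Lemma infl_scm n A lam l v : (size A <= n)%N -> uniq A -> v \in A ->
  (forall w, 0 <= lam w) -> (forall w, w \notin A -> lam w = 0) -> uniq l -> v \notin l ->
  `|occ t g (scm t l lam) v - occ t g lam v| <= \sum_(u <- l) infl n A v u.
Proof.
move=> sA uA vA l0 sl; elim: l => [|u l IH] /=.
  by rewrite big_nil; rewrite (_ : scm t [::] lam = lam) ?subrr ?normr0.
case/andP=> ul uql; rewrite inE negb_or => /andP[vu vl]; rewrite big_cons.
apply: le_trans (ler_distD (occ t g (scm t l lam) v) _ _) _; rewrite lerD ?IH//.
apply: infl_occ => //.
- exact: scm_ge0.
- exact: scm_ge0.
- by move=> w wA; rewrite /scm sl// mulr0 if_same.
- by move=> w wA; rewrite /scm sl// mulr0 if_same.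
- by move=> w wu; rewrite /scm inE (negbTE wu).
- by rewrite eq_sym.
Qed.

(** Passing from [pocc] to plain occupations undoes the scaling of the other neighbours, at the cost
    of their influence on each other once [v] is gone. *)
Lemma occ_phi_approx n A lam v : (size A <= n.+1)%N -> uniq A -> v \in A ->
  (forall w, 0 <= lam w) -> (forall w, w \notin A -> lam w = 0) ->
  forall A', A' = [seq w <- A | w != v] ->
  `|occ t g lam v - phi t (lam v) [seq occ t g (zap v lam) w | w <- nb g A' v]|
  <= \sum_(w <- nb g A' v) \sum_(u <- nb g A' v | u != w) lipc * infl n A' w u.
Proof.
move=> sA uA vA l0 sl _ ->; set A' := [seq w <- A | w != v].
have uA' : uniq A' by rewrite filter_uniq.
have sA' : (size A' <= n)%N by exact: mem_size_filter.
have nbA : nb g A v = nb g A' v.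
  rewrite /nb /A' -filter_predI; apply: eq_filter => w /=.
  by case: eqP => [->|]; rewrite ?gI ?andbT.
have z0 := zap_ge0 v l0.
have supp : forall w, w \notin A' -> zap v lam w = 0.
  move=> w; rewrite mem_filter /zap negb_and negbK; case: eqP => //= _; exact: sl.
have : uniq (nb g A' v) by rewrite filter_uniq.
rewrite (@occ_phi _ _ t g _ _ _ A)// nbA => ul.
apply: le_trans (phi_lip (l0 v) _ _ _) _; rewrite ?size_pocc ?size_map//.
- exact: pocc01.
- by apply/allP => _ /mapP[w _ ->]; rewrite /in01 occ_ge0 ?occ_le1.
(* [pocc] scales only the later neighbours, so the induction runs over suffixes [l], while the inner
   sum of the bound keeps the whole neighbour list. *)
suff H l l1 : l1 ++ l = nb g A' v -> uniq l -> {subset l <= A'} ->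
    wdist (nseq (size l) lipc) (pocc t g l (zap v lam)) [seq occ t g (zap v lam) w | w <- l] <=
    \sum_(w <- l) \sum_(u <- nb g A' v | u != w) lipc * infl n A' w u.
  by apply: (H _ [::]) => // w; rewrite mem_filter => /andP[].
elim: l l1 => [|w l IH] l1 /=.
  by rewrite big_nil.
rewrite -cat_rcons => el /andP[wl ul0] sub; rewrite big_cons lerD//; last first.
  by apply: (IH _ el ul0) => z zl; apply: sub; rewrite inE zl orbT.
have wA' : w \in A' by apply: sub; rewrite mem_head.
rewrite -mulr_sumr ler_wpM2l ?lipc_ge0//.
apply: le_trans (infl_scm sA' uA' wA' z0 supp ul0 wl) _.
rewrite -el big_cat/= big_seq [X in _ <= _ + X]big_seq_cond.
rewrite [X in _ <= _ + X](eq_bigl (fun u => u \in l)) ?lerDr.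
  by apply: sumr_ge0 => ? _; exact: infl_ge0.
by move=> u; case: (boolP (u \in l)) => //= ul'; apply: contraNneq wl => <-.
Qed.

End Influence.

(** * Product Bernoulli expectations over lists *)

Section ProductExpectation.
Variable R : realType.
Implicit Types (x y : seq R) (F : seq bool -> R).

(** The list form of [prodE], see [prodE_seqE]; lists allow induction on the number of spins. *)
Fixpoint seqE x F : R :=
  if x is a :: x' then
    a * seqE x' (fun s => F (true :: s)) + (1 - a) * seqE x' (fun s => F (false :: s))
  else F [::].

Lemma seqE_bounds x F (lo hi : R) : all (@in01 R) x ->
  (forall s, size s = size x -> lo <= F s <= hi) -> lo <= seqE x F <= hi.
Proof.
elim: x F => [|a x IH] F /=; first by move=> _; apply.
case/andP=> /andP[a0 a1] x01 FM.
have /IH/(_ _) := x01 => IHx.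
have /andP[? ?] := IHx (fun s => F (true :: s)) (fun s e => FM (true :: s) (congr1 S e)).
have /andP[? ?] := IHx (fun s => F (false :: s)) (fun s e => FM (false :: s) (congr1 S e)).
by apply/andP; split; nra.
Qed.

(** In each mean [seqE] is affine, its slope being a difference of two conditional expectations,
    both at most [M] in absolute value. *)
Lemma seqE_lip x y F (M : R) : size x = size y -> all (@in01 R) x -> all (@in01 R) y ->
  (forall s, size s = size x -> `|F s| <= M) ->
  `|seqE x F - seqE y F| <= wdist (nseq (size x) (2 * M)) x y.
Proof.
elim: x y F => [|a x IH] [|b y] F //= => [_ _ _ _|[sxy] /andP[a01 x01] /andP[b01 y01] FM].
  by rewrite subrr normr0.
pose Ft s := F (true :: s); pose Ff s := F (false :: s).
have Mt s : size s = size x -> `|Ft s| <= M by move=> h; apply: FM; rewrite /= h.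
have Mf s : size s = size x -> `|Ff s| <= M by move=> h; apply: FM; rewrite /= h.
have IHt := IH y Ft sxy x01 y01 Mt; have IHf := IH y Ff sxy x01 y01 Mf.
have Bt : - M <= seqE y Ft <= M.
  by apply: seqE_bounds => // s; rewrite -sxy => /Mt; rewrite ler_norml.
have Bf : - M <= seqE y Ff <= M.
  by apply: seqE_bounds => // s; rewrite -sxy => /Mf; rewrite ler_norml.
have {Bt Bf} B : `|seqE y Ft - seqE y Ff| <= 2 * M by rewrite ler_norml; lra.
have -> : a * seqE x Ft + (1 - a) * seqE x Ff - (b * seqE y Ft + (1 - b) * seqE y Ff) =
  (a - b) * (seqE y Ft - seqE y Ff) + (a * (seqE x Ft - seqE y Ft) + (1 - a) * (seqE x Ff - seqE y Ff)).
  by ring.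
have /andP[a0 a1] := a01.
apply: (le_trans (ler_normD _ _)); rewrite lerD//; first by rewrite normrM mulrC ler_wpM2r.
apply: (le_trans (ler_normD _ _)); rewrite !normrM (ger0_norm a0) (@ger0_norm _ (1 - a)) ?subr_ge0//.
set w := wdist _ _ _ in IHt IHf *.
have -> : w = a * w + (1 - a) * w by ring.
by rewrite lerD// ler_wpM2l// subr_ge0.
Qed.

Lemma wdist_map (T : eqType) (c : R) (f f' : T -> R) (l : seq T) (B : T -> R) : 0 <= c ->
  (forall v, v \in l -> `|f v - f' v| <= B v) ->
  wdist (nseq (size l) c) (map f l) (map f' l) <= c * \sum_(v <- l) B v.
Proof.
move=> c0; elim: l => [|u l IH] h /=; first by rewrite big_nil mulr0.
rewrite big_cons mulrDr lerD ?ler_wpM2l ?h ?mem_head//.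
by apply: IH => v vl; apply: h; rewrite inE vl orbT.
Qed.

End ProductExpectation.

(** * Near-independence of finitely many spins given their means *)

Section ChainRule.
Variables (R : realType) (V : finType) (t : R) (g : V -> V -> bool).
Hypotheses (t_gt0 : 0 < t) (t_le1 : t <= 1).
Hypotheses (gC : forall i j, g i j = g j i) (gI : forall i, g i i = false).
Implicit Types (lam : V -> R) (v w : V) (A : seq V).

(* Comparing with the weight at [u] for which [u] is occupied with probability 1/2. *)
Lemma infl_cond n A lam v u : (size A <= n)%N -> uniq A -> v \in A -> u \in A -> u != v ->
  (forall w, 0 <= lam w) -> (forall w, w \notin A -> lam w = 0) ->
  `|occ t g (scl t g u lam) v - occ t g (zap u lam) v| <= 2 * infl t g n A v u.
Proof.
move=> sA uA vA uA' uv l0 sl.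
have z0 := zap_ge0 u l0; have s0 := scl_ge0 t g u l0.
have Z0 := wsum_gt0 g t_gt0 z0; have S0 := wsum_gt0 g t_gt0 s0.
pose x := wsum t g (zap u lam) (fun=> 1) / wsum t g (scl t g u lam) (fun=> 1).
pose lam' w := if w == u then x else lam w.
have x0 : 0 <= x by rewrite divr_ge0 ?ltW.
have l0' w : 0 <= lam' w by rewrite /lam'; case: ifP.
have ez : zap u lam' = zap u lam.
  by apply/funext => w; rewrite /zap /lam'; case: eqP.
have es : scl t g u lam' = scl t g u lam.
  by apply/funext => w; rewrite /scl /lam'; case: eqP.
have hf : occ t g lam' u = 1 / 2.
  rewrite occE// (@wsum_split _ _ t g lam' u)// es ez /lam' eqxx /x divfK ?gt_eqF//.
  by field; rewrite gt_eqF// addr_gt0.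
have e : occ t g lam' v = 1 / 2 * occ t g (scl t g u lam) v + 1 / 2 * occ t g (zap u lam) v.
  rewrite {1}/occ (avg_split t_gt0 gC gI u _ l0') hf es ez; congr (_ * _ + _ * _); last first.
    by field.
  congr (_ / _); apply: eq_bigr => s _; by rewrite updE eq_sym (negbTE uv).
have := @infl_occ _ _ t g t_gt0 t_le1 gC gI n A lam' (zap u lam) v u sA uA vA l0' z0 _ _ _ uv.
rewrite e => H.
have -> : occ t g (scl t g u lam) v - occ t g (zap u lam) v =
  2 * (1 / 2 * occ t g (scl t g u lam) v + 1 / 2 * occ t g (zap u lam) v - occ t g (zap u lam) v).
  by field.
rewrite normrM ger0_norm// ler_wpM2l//; apply: H => w wA.
- by rewrite /lam'; case: eqP wA => [->|_]; rewrite ?uA'//; exact: sl.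
- by rewrite /zap sl// if_same.
- by rewrite /lam' /zap (negbTE wA).
Qed.

(** The unconditioned occupation is a convex combination of the two conditioned ones, so it is no
    farther from either than they are from each other. *)
Lemma infl_cond2 n A lam v u : (size A <= n)%N -> uniq A -> v \in A -> u \in A -> u != v ->
  (forall w, 0 <= lam w) -> (forall w, w \notin A -> lam w = 0) ->
  `|occ t g (scl t g u lam) v - occ t g lam v| <= 2 * infl t g n A v u /\
  `|occ t g (zap u lam) v - occ t g lam v| <= 2 * infl t g n A v u.
Proof.
move=> sA uA vA uA' uv l0 sl.
have := infl_cond sA uA vA uA' uv l0 sl.
have e : occ t g lam v = occ t g lam u * occ t g (scl t g u lam) v +
    (1 - occ t g lam u) * occ t g (zap u lam) v.
  rewrite {1}/occ (avg_split t_gt0 gC gI u _ l0); congr (_ * (_ / _) + _).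
  by apply: eq_bigr => s _; rewrite updE eq_sym (negbTE uv).
have := occ_ge0 t_gt0 gC gI u l0; have := occ_le1 t_gt0 gC gI u l0.
rewrite e !ler_norml; move: (occ t g lam u) (occ t g (scl t g u lam) v) (occ t g (zap u lam) v).
by move=> m a b m1 m0 /andP[h1 h2]; split; apply/andP; split; nra.
Qed.

Fixpoint infl_pairs n A (l : seq V) : R :=
  if l is u :: l' then \sum_(v <- l') infl t g n A v u + infl_pairs n A l' else 0.

Lemma avg_zap_eq lam u (F F' : {ffun V -> bool} -> R) :
  (forall s : {ffun V -> bool}, s u = false -> F s = F' s) ->
  avg t g (zap u lam) F = avg t g (zap u lam) F'.
Proof.
move=> e; congr (_ / _); apply: eq_bigr => s _; rewrite wt_zap.
by case: ifP => [|/e ->//]; rewrite !mul0r.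
Qed.

Lemma map_occ01 lam (l : seq V) : (forall v, 0 <= lam v) -> all (@in01 R) (map (occ t g lam) l).
Proof. by move=> l0; apply/allP => _ /mapP[w _ ->]; rewrite /in01 occ_ge0 ?occ_le1. Qed.

(** The spins of [l] are revealed one by one. A revealed spin moves each later mean by at most twice
    an influence, and [seqE] moves by [2 * M] per unit of mean; hence the factor 4. *)
Lemma avg_chain n A lam (l : seq V) (F : seq bool -> R) (M : R) :
  (size A <= n)%N -> uniq A -> {subset l <= A} -> uniq l ->
  (forall w, 0 <= lam w) -> (forall w, w \notin A -> lam w = 0) ->
  (forall s, size s = size l -> `|F s| <= M) ->
  `|avg t g lam (fun s => F (map s l)) - seqE (map (occ t g lam) l) F|
    <= 4 * M * infl_pairs n A l.
Proof.
move=> sA uA; elim: l lam F => [|u l IH] lam F /= sub ul l0 sl FM.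
  rewrite mulr0 /avg /wsum -[X in X / _]mulr_suml -[X in _ / X]mulr_suml mulr1.
  rewrite mulrAC divff ?mul1r ?subrr ?normr0//.
  by have := lt0r_neq0 (wsum_gt0 g t_gt0 l0); rewrite /wsum -mulr_suml mulr1.
case/andP: ul => nul ul.
have M0 : 0 <= M by apply: le_trans (FM (nseq (size l).+1 true) _); rewrite ?normr_ge0// size_nseq.
have z0 := zap_ge0 u l0; have s0 := scl_ge0 t g u l0.
have uA' : u \in A by apply: sub; rewrite mem_head.
have sub' : {subset l <= A} by move=> w wl; apply: sub; rewrite inE wl orbT.
rewrite (avg_split t_gt0 gC gI u _ l0).
pose Ft s := F (true :: s); pose Ff s := F (false :: s).
have -> : avg t g (scl t g u lam) (fun s => F (upd s u true u :: map (upd s u true) l)) =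
    avg t g (scl t g u lam) (fun s => Ft (map s l)).
  congr (_ / _); apply: eq_bigr => s _; rewrite updE eqxx; congr (_ * F (_ :: _)).
  by apply/eq_in_map => w wl; rewrite updE; case: eqP nul => // <-; rewrite wl.
rewrite (@avg_zap_eq _ _ _ (fun s : {ffun V -> bool} => Ff (map s l))) => [|s su]; last by rewrite su.
have Mt s : size s = size l -> `|Ft s| <= M by move=> h; apply: FM; rewrite /= h.
have Mf s : size s = size l -> `|Ff s| <= M by move=> h; apply: FM; rewrite /= h.
have H1 := IH (scl t g u lam) Ft sub' ul s0 _ Mt.
have H2 := IH (zap u lam) Ff sub' ul z0 _ Mf.
have {}H1 := H1 _; have {}H2 := H2 _.
have cond v : v \in l -> u != v.
  by move=> vl; apply: contraNneq nul => ->.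
have M2 : 0 <= 2 * M by rewrite mulr_ge0.
have D1 : `|seqE (map (occ t g (scl t g u lam)) l) Ft - seqE (map (occ t g lam) l) Ft| <=
    2 * M * \sum_(v <- l) 2 * infl t g n A v u.
  apply: le_trans (seqE_lip _ (map_occ01 _ s0) (map_occ01 _ l0) _) _; rewrite ?size_map//.
    exact: Mt.
  apply: (@wdist_map _ _ _ _ _ _ (fun v => 2 * infl t g n A v u)) => // v vl.
  by have [] := infl_cond2 sA uA (sub' _ vl) uA' (cond _ vl) l0 sl.
have D2 : `|seqE (map (occ t g (zap u lam)) l) Ff - seqE (map (occ t g lam) l) Ff| <=
    2 * M * \sum_(v <- l) 2 * infl t g n A v u.
  apply: le_trans (seqE_lip _ (map_occ01 _ z0) (map_occ01 _ l0) _) _; rewrite ?size_map//.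
    exact: Mf.
  apply: (@wdist_map _ _ _ _ _ _ (fun v => 2 * infl t g n A v u)) => // v vl.
  by have [] := infl_cond2 sA uA (sub' _ vl) uA' (cond _ vl) l0 sl.
have {}H1 : `|avg t g (scl t g u lam) (fun s => Ft (map s l)) -
    seqE (map (occ t g lam) l) Ft| <= 4 * M * (\sum_(v <- l) infl t g n A v u + infl_pairs n A l).
  apply: le_trans (ler_distD (seqE (map (occ t g (scl t g u lam)) l) Ft) _ _) _.
  rewrite mulrDr addrC lerD//; last first.
    by apply: H1 => w wA; rewrite /scl sl// mulr0 !if_same.
  by apply: le_trans D1 _; rewrite -mulr_sumr mulrA [2 * M * 2]mulrAC -natrM.
have {}H2 : `|avg t g (zap u lam) (fun s => Ff (map s l)) -
    seqE (map (occ t g lam) l) Ff| <= 4 * M * (\sum_(v <- l) infl t g n A v u + infl_pairs n A l).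
  apply: le_trans (ler_distD (seqE (map (occ t g (zap u lam)) l) Ff) _ _) _.
  rewrite mulrDr addrC lerD//; last first.
    by apply: H2 => w wA; rewrite /zap sl// if_same.
  by apply: le_trans D2 _; rewrite -mulr_sumr mulrA [2 * M * 2]mulrAC -natrM.
move: H1 H2; rewrite -/Ft -/Ff !ler_norml.
have := occ_ge0 t_gt0 gC gI u l0; have := occ_le1 t_gt0 gC gI u l0.
set B := 4 * M * _; set m := occ _ _ _ _; set a := avg _ _ _ _; set b := avg _ _ _ _.
set c := seqE _ _; set d := seqE _ _ => m1 m0 /andP[h1 h2] /andP[h3 h4].
by apply/andP; split; nra.
Qed.

End ChainRule.

(** * Expectation over the random graph and exposure of the edges at a vertex *)

Section RandomGraph.
Variables (R : realType) (N : nat) (c : R).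
Let p : R := c / N%:R.
Hypotheses (p_ge0 : 0 <= p) (p_le1 : p <= 1).
Implicit Types (G : {ffun edge N -> bool}) (F : {ffun edge N -> bool} -> R).

Local Notation E F := (@Egraph R N c F).
Local Notation prob G := (\prod_(e : edge N) (if G e then p else 1 - p)).

Lemma Egraph_sum (I : Type) (r : seq I) (P : pred I) (F : I -> {ffun edge N -> bool} -> R) :
  E (fun G => \sum_(i <- r | P i) F i G) = \sum_(i <- r | P i) E (F i).
Proof.
rewrite /Egraph exchange_big/=; apply: eq_bigr => G _.
by rewrite mulr_sumr.
Qed.

Lemma EgraphD F F' : E (fun G => F G + F' G) = E F + E F'.
Proof. by rewrite /Egraph -big_split/=; apply: eq_bigr => G _; rewrite mulrDr. Qed.

Lemma EgraphZ a F : E (fun G => a * F G) = a * E F.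
Proof. by rewrite /Egraph mulr_sumr; apply: eq_bigr => G _; rewrite mulrCA. Qed.

Lemma EgraphN F : E (fun G => - F G) = - E F.
Proof. by rewrite -mulN1r -EgraphZ; apply: eq_bigr => G _; rewrite mulN1r. Qed.

Lemma Egraph1 : E (fun=> 1) = 1.
Proof.
rewrite /Egraph (eq_bigr (fun G => prob G)) => [|G _]; last by rewrite mulr1.
rewrite -(bigA_distr_bigA (fun (_ : edge N) b => if b then p else 1 - p))/=.
by rewrite big1// => e _; rewrite big_bool/= addrC subrK.
Qed.

Lemma Egraph_cst a : E (fun=> a) = a.
Proof. by rewrite -[in LHS](mulr1 a) (EgraphZ a (fun=> 1)) Egraph1 mulr1. Qed.

Lemma prob_ge0 G : 0 <= prob G.
Proof. by apply: prodr_ge0 => e _; case: ifP => // _; rewrite subr_ge0. Qed.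

Lemma le_Egraph F F' : (forall G, F G <= F' G) -> E F <= E F'.
Proof. by move=> h; apply: ler_sum => G _; rewrite ler_wpM2l// prob_ge0. Qed.

Lemma le_normr_Egraph F : `|E F| <= E (fun G => `|F G|).
Proof.
apply: le_trans (ler_norm_sum _ _ _) _; apply: ler_sum => G _.
by rewrite normrM ger0_norm// prob_ge0.
Qed.

Lemma Egraph_resample e F :
  E F = p * E (fun G => F (upd G e true)) + (1 - p) * E (fun G => F (upd G e false)).
Proof. exact: sum_resample. Qed.

Definition adj G (i j : 'I_N) : bool :=
  if (insub (i, j) : option (edge N)) is Some e then G e
  else if (insub (j, i) : option (edge N)) is Some e then G e else false.

Lemma adjC G i j : adj G i j = adj G j i.
Proof.
rewrite /adj; case: insubP => [e|] /=; case: insubP => [e'|] //= h1 _ h2.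
by have := ltn_trans h1 h2; rewrite ltnn.
Qed.

Lemma adjI G i : adj G i i = false.
Proof. by rewrite /adj; case: insubP => //= e; rewrite ltnn. Qed.

Lemma adj_lt G (e : edge N) : adj G (val e).1 (val e).2 = G e.
Proof. by rewrite /adj -surjective_pairing valK. Qed.

Lemma edge_between (v w : 'I_N) : v != w -> exists e : edge N, forall G b i j,
  adj (upd G e b) i j =
    if (i == v) && (j == w) || (i == w) && (j == v) then b else adj G i j.
Proof.
wlog vw : v w / (v < w)%N => [H|_].
  case: (ltngtP v w) => [vw|vw|/val_inj->]; last by rewrite eqxx.
    exact: H.
  rewrite eq_sym => /(H _ _ vw)[e he]; exists e => G b i j.
  by rewrite he orbC.
pose e : edge N := Sub (v, w) vw; exists e => G b i j.
have ne : v != w by rewrite -val_eqE neq_ltn vw.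
rewrite /adj; case: insubP => [e1 h1 v1|h1].
  rewrite updE -val_eqE v1 /= xpair_eqE.
  case: (boolP (_ && _)) => //= n1; case: andP => // -[/eqP iw /eqP jv].
  by move: h1; rewrite /= iw jv => /(ltn_trans vw); rewrite ltnn.
have -> : (i == v) && (j == w) = false.
  by apply/negbTE; apply: contra h1 => /andP[/eqP -> /eqP ->].
case: insubP => [e1 h2 v1|h2] /=; first by rewrite updE -val_eqE v1 /= xpair_eqE andbC.
case: andP => // -[/eqP iw /eqP jv].
by move: h2; rewrite /= iw jv vw.
Qed.

(** Independence from the edges at [v], expressed without sigma-algebras: [F] reads only the graph
    with [v] removed. *)
Definition off (v : 'I_N) (T : Type) (F : {ffun edge N -> bool} -> T) :=
  forall G G', (forall i j, i != v -> j != v -> adj G i j = adj G' i j) -> F G = F G'.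

Lemma off_upd v w (T : Type) (F : _ -> T) G e b : off v F ->
  (forall G b i j, adj (upd G e b) i j =
    if (i == v) && (j == w) || (i == w) && (j == v) then b else adj G i j) ->
  F (upd G e b) = F G.
Proof.
by move=> oF he; apply: oF => i j iv jv; rewrite he (negbTE iv) (negbTE jv) andbF.
Qed.

Lemma Egraph_edge v w F : v != w -> off v F ->
  E (fun G => (adj G v w)%:R * F G) = p * E F.
Proof.
move=> vw oF; have [e he] := edge_between vw.
rewrite (Egraph_resample e).
rewrite [X in _ + _ * X](_ : _ = 0) ?mulr0 ?addr0; last first.
  by apply: big1 => G _; rewrite he !eqxx mul0r mulr0.
congr (_ * _); apply: eq_bigr => G _; rewrite he !eqxx mul1r.
by rewrite (off_upd _ _ oF he).
Qed.

(** Expectation over a random sublist of [l] in which each entry is kept independently with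
    probability [p]. *)
Fixpoint subE (T : Type) (l : seq T) (f : seq T -> R) : R :=
  if l is w :: l' then p * subE l' (fun S => f (w :: S)) + (1 - p) * subE l' f else f [::].

(** The edges from [v] to [l] are independent of each other and of all that is [off v]; resampling
    them in turn makes the neighbourhood of [v] in [l] a random sublist. *)
Lemma Egraph_expose v l (f : seq 'I_N -> {ffun edge N -> bool} -> R) :
  uniq l -> v \notin l -> (forall S, off v (f S)) ->
  E (fun G => f (nb (adj G) l v) G) = subE l (fun S => E (f S)).
Proof.
elim: l f => [|w l IH] f //= /andP[wl ul]; rewrite inE negb_or => /andP[vw vl] of_.
have [e he] := edge_between vw; rewrite (Egraph_resample e).
have nbu G b : nb (adj (upd G e b)) l v = nb (adj G) l v.
  apply: eq_in_filter => u ul'; rewrite he eqxx (negbTE vw)/=.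
  by case: eqP => //= uw; rewrite -uw ul' in wl.
rewrite -(IH (fun S => f (w :: S)))// -(IH f)//; congr (_ * _ + _ * _); apply: eq_bigr => G _.
  by rewrite {1}/nb/= he !eqxx/= -/(nb _ _ _) nbu (off_upd _ _ (of_ _) he).
by rewrite {1}/nb/= he !eqxx/= -/(nb _ _ _) nbu (off_upd _ _ (of_ _) he).
Qed.

Lemma le_subE (T : eqType) (l : seq T) (f f' : seq T -> R) :
  (forall S, subseq S l -> f S <= f' S) -> subE l f <= subE l f'.
Proof.
elim: l f f' => [|w l IH] f f' h /=; first exact: h.
rewrite lerD// ler_wpM2l ?subr_ge0//; apply: IH => S sl; apply: h.
  by rewrite /= eqxx.
exact: subseq_trans sl (subseq_cons _ _).
Qed.

Lemma eq_subE (T : Type) (l : seq T) (f f' : seq T -> R) :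
  (forall S, f S = f' S) -> subE l f = subE l f'.
Proof. by elim: l f f' => [|w l IH] f f' h //=; congr (_ * _ + _ * _); apply: IH => S. Qed.

Lemma subED (T : Type) (l : seq T) (f f' : seq T -> R) :
  subE l (fun S => f S + f' S) = subE l f + subE l f'.
Proof. by elim: l f f' => [|w l IH] f f' //=; rewrite !IH; ring. Qed.

Lemma subEZ (T : Type) (l : seq T) a (f : seq T -> R) :
  subE l (fun S => a * f S) = a * subE l f.
Proof. by elim: l f => [|w l IH] f //=; rewrite !IH; ring. Qed.

Lemma subE_cst (T : Type) (l : seq T) a : subE l (fun=> a) = a.
Proof. by elim: l => [|w l IH] //=; rewrite !IH; ring. Qed.

Lemma subE_size (T : Type) (l : seq T) : subE l (fun S => (size S)%:R) = p * (size l)%:R.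
Proof.
elim: l => [|w l IH] /=; first by rewrite mulr0.
rewrite (eq_subE l (f' := fun S => 1 + (size S)%:R)); last by move=> S; rewrite -nat1r.
by rewrite subED subE_cst IH -nat1r; ring.
Qed.

(** Second moment of a binomial variable, with the negative part of its variance dropped. *)
Lemma subE_size2 (T : Type) (l : seq T) :
  subE l (fun S => (size S)%:R ^+ 2) <= p * (size l)%:R + (p * (size l)%:R) ^+ 2.
Proof.
elim: l => [|w l IH] /=; first by rewrite mulr0 expr0n addr0.
rewrite (eq_subE l (f' := fun S => 1 + (2 * (size S)%:R + (size S)%:R ^+ 2))); last first.
  by move=> S; rewrite -nat1r; ring.
rewrite !subED subEZ subE_cst subE_size -[(size l).+1%:R]nat1r; set s := subE _ _ in IH *.
have -> : p * (1 + (2 * (p * (size l)%:R) + s)) + (1 - p) * s =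
   p + 2 * p * (p * (size l)%:R) + s by ring.
by apply: le_trans (lerD (lexx _) IH) _; rewrite -subr_ge0; have := sqr_ge0 p; nra.
Qed.

End RandomGraph.

(** * Expected influence in the sparse random graph *)

Section ExpectedInfluence.
Variables (R : realType) (N : nat) (c t : R).
Let p : R := c / N%:R.
Let L : R := lipc t.
Hypotheses (t_gt0 : 0 < t) (t_le1 : t <= 1) (p_ge0 : 0 <= p) (p_le1 : p <= 1).
Hypothesis Lp : L * (p * N%:R) <= 1 / 2.
Implicit Types (A l : seq 'I_N) (lam : 'I_N -> R).

Local Notation E F := (@Egraph R N c F).
Local Notation occG G lam := (occ t (adj G) lam).

Let L_ge0 : 0 <= L. Proof. exact: lipc_ge0. Qed.

Lemma eq_infl (V : finType) (g g' : V -> V -> bool) n (A : seq V) v u :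
  (forall i j, i \in A -> j \in A -> g i j = g' i j) -> v \in A ->
  infl t g n A v u = infl t g' n A v u.
Proof.
elim: n A v => //= n IH A v e vA; rewrite big_seq [RHS]big_seq.
apply: eq_bigr => w; rewrite mem_filter => /andP[wv wA]; rewrite e//; congr (_ * (_ + _)).
apply: IH; last by rewrite mem_filter wv.
by move=> i j; rewrite !mem_filter => /andP[_ iA] /andP[_ jA]; exact: e.
Qed.

Lemma off_infl n A v w u : v \notin A -> w \in A -> off v (fun G => infl t (adj G) n A w u).
Proof.
move=> vA wA G G' e; apply: eq_infl => // i j iA jA.
by apply: e; [apply: contraNneq vA => <-|apply: contraNneq vA => <-].
Qed.

(** A site of weight 0 is never occupied in a configuration of nonzero weight, so its edges do not
    matter. *)
Lemma eq_occ (V : finType) (g g' : V -> V -> bool) (lam : V -> R) v w :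
  (forall i j, i != v -> j != v -> g i j = g' i j) -> lam v = 0 ->
  occ t g lam w = occ t g' lam w.
Proof.
move=> e lv; have ewt s : wt t g lam s = wt t g' lam s.
  rewrite /wt; case: (boolP (s v)) => sv.
    by rewrite (bigD1 v)//= sv lv !mul0r.
  congr (_ * _); apply: eq_bigr => i _; apply: eq_bigr => j _.
  case: (eqVneq i v) => [->|iv]; first by rewrite (negbTE sv).
  case: (eqVneq j v) => [->|jv]; first by rewrite (negbTE sv) andbF.
  by rewrite e.
by rewrite /occ /avg; congr (_ / _); apply: eq_bigr => s _; rewrite ewt.
Qed.

Lemma off_occ lam v w : off v (fun G => occG G (zap v lam) w).
Proof. by move=> G G' e; apply: (eq_occ _ e); rewrite /zap eqxx. Qed.

Lemma size_uniq_ord A : uniq A -> (size A <= N)%N.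
Proof. by move=> /card_uniqP <-; rewrite -[X in (_ <= X)%N]card_ord max_card. Qed.

Lemma sum_indic (T : eqType) (l : seq T) u : uniq l -> \sum_(w <- l) (w == u)%:R <= (1 : R).
Proof.
elim: l => [|w l IH] /=; first by rewrite big_nil.
case/andP=> wl /IH {}IH; rewrite big_cons; case: eqP => [<-|]; last by rewrite add0r.
rewrite big_seq big1 ?addr0// => x xl; case: eqP => // xw.
by rewrite -xw xl in wl.
Qed.

Lemma sumr_le_const (T : eqType) (l : seq T) (P : pred T) (f : T -> R) (M : R) (n : nat) :
  (size l <= n)%N -> 0 <= M -> (forall x, x \in l -> f x <= M) ->
  \sum_(x <- l | P x) f x <= n%:R * M.
Proof.
move=> sl M0 h; apply: (@le_trans _ _ ((size l)%:R * M)); last first.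
  by rewrite ler_wpM2r// ler_nat.
elim: l h {sl} => [|x l IH] h; first by rewrite big_nil mul0r.
rewrite big_cons /= -nat1r mulrDl mul1r.
have {}IH := IH (fun y yl => h y (mem_behead (s := x :: l) yl)).
case: ifP => _; first by rewrite lerD// h// mem_head.
by rewrite (le_trans IH)// lerDr.
Qed.

(** The first edge of a path from [v] is independent of the influence in the graph without [v]. The
    bound M = 2 L p reproduces itself, as L p (1 + N M) <= M when L p N <= 1/2, so it holds for
    every fuel [n]. *)
Lemma Einfl n A v u : uniq A -> v \in A -> E (fun G => infl t (adj G) n A v u) <= 2 * L * p.
Proof.
have Lp0 : 0 <= L * p by rewrite mulr_ge0.
have M0 : 0 <= 2 * L * p by rewrite -mulrA mulr_ge0.
elim: n A v => [|n IH] A v uA vA.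
  by rewrite Egraph_cst.
set A' := [seq w <- A | w != v].
have uA' : uniq A' by rewrite filter_uniq.
have -> : E (fun G => infl t (adj G) n.+1 A v u) =
    \sum_(w <- A') (L * p) * ((w == u)%:R + E (fun G => infl t (adj G) n A' w u)).
  rewrite -/A' Egraph_sum/= -/A' big_seq [RHS]big_seq; apply: eq_bigr => w wA'.
  have wv : v != w by move: wA'; rewrite mem_filter eq_sym => /andP[].
  have vA' : v \notin A' by rewrite mem_filter eqxx.
  rewrite -mulrA [p * _](_ : _ = E (fun G => (adj G v w)%:R * ((w == u)%:R + infl t (adj G) n A' w u))).
    by rewrite -EgraphZ; apply: eq_bigr => G _; rewrite !mulrA.
  rewrite Egraph_edge//; first by rewrite EgraphD// Egraph_cst.
  by move=> G G' e; congr (_ + _); exact: (off_infl n u vA' wA' e).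
rewrite -mulr_sumr big_split/=.
apply: (@le_trans _ _ (L * p * (1 + N%:R * (2 * L * p)))).
  rewrite ler_wpM2l// lerD ?sum_indic//.
  by apply: sumr_le_const => //; [exact: size_uniq_ord|move=> w wA'; exact: IH].
rewrite -[2 * _ * _]mulrA [X in _ <= X]mulrC ler_wpM2l//. by move: Lp; lra.
Qed.

Lemma Eocc_zap A lam v u : uniq A -> v \in A -> u \in A -> u != v ->
  (forall w, 0 <= lam w) -> (forall w, w \notin A -> lam w = 0) ->
  E (fun G => `|occG G lam u - occG G (zap v lam) u|) <= 2 * L * p.
Proof.
move=> uA vA uA' uv l0 sl.
apply: le_trans (Einfl (size A) v uA uA'); apply: le_Egraph => // G.
apply: infl_occ => //; first exact: adjC.
- exact: adjI.
- exact: zap_ge0.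
- by move=> w wA; rewrite /zap sl// if_same.
- by move=> w wv; rewrite /zap (negbTE wv).
- by rewrite eq_sym.
Qed.

(** There are at most N^2 pairs of possible neighbours; both edges to [v] are present with
    probability p^2, independently of the influence without [v], whose mean is at most
    [2 * L * p]. *)
Lemma Eocc_phi A lam v : uniq A -> v \in A ->
  (forall w, 0 <= lam w) -> (forall w, w \notin A -> lam w = 0) ->
  E (fun G => `|occG G lam v -
     phi t (lam v) [seq occG G (zap v lam) w | w <- nb (adj G) [seq w <- A | w != v] v]|)
  <= 2 * L ^+ 2 * p * (p * N%:R) ^+ 2.
Proof.
move=> uA vA l0 sl; set A' := [seq w <- A | w != v].
have uA' : uniq A' by rewrite filter_uniq.
have vA' : v \notin A' by rewrite mem_filter eqxx.
have sA : (size A <= (size A).+1)%N by [].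
apply: (@le_trans _ _ (E (fun G => \sum_(w <- A') \sum_(u <- A' | u != w)
    L * ((adj G v w)%:R * ((adj G v u)%:R * infl t (adj G) (size A) A' w u))))).
  apply: le_Egraph => // G.
  have := @occ_phi_approx _ _ t (adj G) t_gt0 t_le1 (adjC G) (adjI G) _ A lam v sA uA vA l0 sl _ erefl.
  move/le_trans; apply; rewrite -/A' /nb big_filter big_mkcond/=; apply: ler_sum => w _.
  case: (adj G v w); last by rewrite big1// => u _; rewrite mul0r mulr0.
  rewrite big_filter_cond [X in _ <= X]big_mkcond [X in X <= _]big_mkcond/=.
  apply: ler_sum => u _; case: (adj G v u) => /=; last by rewrite mul0r mulr0 mulr0 if_same.
  by rewrite !mul1r.
rewrite Egraph_sum big_seq.
have M0 : 0 <= L * (p * (p * (2 * L * p))).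
  by do 6?[apply: mulr_ge0 => //].
have -> : 2 * L ^+ 2 * p * (p * N%:R) ^+ 2 =
    N%:R * (N%:R * (L * (p * (p * (2 * L * p))))) by ring.
rewrite -big_seq; apply: sumr_le_const => [||w wA'].
- exact: size_uniq_ord.
- exact: mulr_ge0.
rewrite Egraph_sum big_seq_cond.
apply: (@le_trans _ _ (\sum_(u <- A' | u != w) L * (p * (p * (2 * L * p))))).
  rewrite [X in _ <= X]big_seq_cond; apply: ler_sum => u /andP[uA1 uw].
  rewrite EgraphZ ler_wpM2l//.
  have [wv uv] : v != w /\ v != u.
    by split; [apply: contraNneq vA' => ->|apply: contraNneq vA' => ->].
  have [e he] := edge_between uv.
  have oi : off v (fun G => infl t (adj G) (size A) A' w u) by exact: off_infl.
  rewrite (_ : E _ = p * (p * E (fun G => infl t (adj G) (size A) A' w u))).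
    by rewrite !ler_wpM2l// Einfl.
  (* The edge to [u] is resampled by hand: the remaining factor still reads the edge from [v] to
     [w], so it is not [off v]. *)
  rewrite (Egraph_resample _ e).
  rewrite [X in _ + _ * X](_ : _ = 0) ?mulr0 ?addr0; last first.
    by apply: big1 => G _; rewrite (he _ _ v u) !eqxx/= mul0r !mulr0.
  congr (_ * _); rewrite -(Egraph_edge _ wv oi); apply: eq_bigr => G _.
  rewrite !he !eqxx/= mul1r (off_upd _ _ oi he).
  by rewrite [w == u]eq_sym (negbTE uw) (negbTE uv).
by apply: sumr_le_const => //; exact: size_uniq_ord.
Qed.

(** A neighbour of mean 0 contributes the factor 1, so dropping it amounts to changing its mean to
    0, by at most 1. *)
Lemma phi_drop (V : finType) (g : V -> V -> bool) (a : R) (m : V -> R) (A : seq V) (P : pred V) v :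
  0 <= a -> (forall w, in01 (m w)) ->
  `|phi t a (map m (nb g A v)) - phi t a (map m (nb g [seq w <- A | P w] v))|
    <= L * \sum_(w <- A | ~~ P w) (g v w)%:R.
Proof.
move=> a0 m01; pose m' w := if P w then m w else 0.
have -> : phi t a (map m (nb g [seq w <- A | P w] v)) = phi t a (map m' (nb g A v)).
  rewrite /phi (_ : odds _ _ _ = odds t a (map m' (nb g A v)))// /odds; congr (_ * _).
  rewrite !big_map /nb [RHS]big_filter [LHS]big_filter big_filter_cond.
  rewrite [LHS]big_mkcond [RHS]big_mkcond/=.
  by apply: eq_bigr => w _ /=; rewrite /m'; case: (g v w); case: (P w); rewrite ?mulr0 ?subr0.
apply: le_trans (phi_lip _ _ a0 _ _ _) _ => //; rewrite ?size_map//.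
- by apply/allP => _ /mapP[w _ ->].
- apply/allP => _ /mapP[w _ ->]; rewrite /m'; case: ifP => // _.
  by rewrite /in01 lexx ler01.
apply: (le_trans (@wdist_map _ _ L _ _ _ (fun w => (~~ P w)%:R) _ _)) => //.
  move=> w _; rewrite /m'; case: (P w) => /=; first by rewrite subrr normr0.
  by rewrite subr0 ger0_norm; have /andP[] := m01 w.
rewrite ler_wpM2l// /nb big_filter big_mkcond [X in _ <= X]big_mkcond/=.
by apply: ler_sum => w _; case: (g v w); case: (P w).
Qed.

Lemma Ephi_drop A lam (P : pred 'I_N) v k : uniq A -> v \notin A -> 0 <= lam v ->
  (forall w, 0 <= lam w) -> (size [seq w <- A | ~~ P w] <= k)%N ->
  E (fun G => `|phi t (lam v) [seq occG G (zap v lam) w | w <- nb (adj G) A v] -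
     phi t (lam v) [seq occG G (zap v lam) w | w <- nb (adj G) [seq w <- A | P w] v]|)
  <= L * (k%:R * p).
Proof.
move=> uA vA lv l0 sk.
apply: (@le_trans _ _ (E (fun G => L * \sum_(w <- A | ~~ P w) (adj G v w)%:R))).
  apply: le_Egraph => // G; apply: phi_drop => // w.
  by rewrite /in01 occ_ge0 ?occ_le1//; (exact: adjC || exact: adjI || exact: zap_ge0).
rewrite EgraphZ ler_wpM2l// Egraph_sum -big_filter.
apply: sumr_le_const => // w; rewrite mem_filter => /andP[_ wA].
have vw : v != w by apply: contraNneq vA => ->.
rewrite (_ : E _ = p * E (fun=> 1)); first by rewrite Egraph1 mulr1.
by rewrite -(@Egraph_edge _ _ _ v w)//; apply: eq_bigr => G _; rewrite mulr1.
Qed.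

End ExpectedInfluence.

(** * Poisson expectations bounded by binomial ones *)

Section BinomialPoisson.
Variables (R : realType) (N : nat) (c : R).
Let p : R := c / N%:R.
Hypotheses (c_ge0 : 0 <= c) (N_gt0 : (0 < N)%N) (c_le : c <= N%:R).

Let N0 : 0 < N%:R :> R. Proof. by rewrite ltr0n. Qed.
Let p_ge0 : 0 <= p. Proof. by rewrite divr_ge0 // ltW. Qed.
Let p_le1 : p <= 1. Proof. by rewrite ler_pdivrMr// mul1r. Qed.

Lemma pois_ge0 s : 0 <= pois c s.
Proof. by rewrite /pois !mulr_ge0 ?expR_ge0 ?exprn_ge0// invr_ge0. Qed.

Lemma sum_pois_le1 n : \sum_(0 <= s < n) pois c s <= 1.
Proof.
have -> : \sum_(0 <= s < n) pois c s = expR (- c) * series (exp_coeff c) n.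
  by rewrite /series/= mulr_sumr; apply: eq_bigr => s _; rewrite /pois /exp_coeff mulrA.
rewrite -[X in _ <= X](expRxMexpNx_1 c) mulrC ler_wpM2r ?expR_ge0//.
apply: nondecreasing_cvgn_le; last exact: is_cvg_series_exp_coeff.
by apply/nondecreasing_seqP => k; rewrite /series/= big_nat_recr//= lerDl exp_coeff_ge0.
Qed.

Lemma poisS s : pois c s.+1 * s.+1%:R = c * pois c s.
Proof.
rewrite /pois factS natrM exprS.
have s0 : s.+1%:R != 0 :> R by rewrite pnatr_eq0.
have f0 : s`!%:R != 0 :> R by rewrite pnatr_eq0 -lt0n fact_gt0.
by move: (s.+1%:R) s0 => a a0; field; rewrite a0 f0.
Qed.

(** The size-bias identity of the Poisson law; its first two moments follow from it. *)
Lemma sum_pois_shift (h : nat -> R) n : \sum_(0 <= s < n.+1) pois c s * (s%:R * h s) =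
  c * \sum_(0 <= s < n) pois c s * h s.+1.
Proof.
rewrite big_nat_recl// mul0r mulr0 add0r mulr_sumr; apply: eq_bigr => s _.
by rewrite mulrA poisS mulrA.
Qed.

Lemma sum_pois_size n : \sum_(0 <= s < n) pois c s * s%:R <= c.
Proof.
case: n => [|n]; first by rewrite big_geq.
rewrite (eq_bigr (fun s => pois c s * (s%:R * 1))) => [|s _]; last by rewrite mulr1.
rewrite (sum_pois_shift (fun=> 1)) -[X in _ <= X]mulr1 ler_wpM2l//.
by under eq_bigr do rewrite mulr1; exact: sum_pois_le1.
Qed.

Lemma sum_pois_size2 n : \sum_(0 <= s < n) pois c s * s%:R ^+ 2 <= c * (1 + c).
Proof.
case: n => [|n]; first by rewrite big_geq// mulr_ge0// addr_ge0.
rewrite (sum_pois_shift (fun s => s%:R)) ler_wpM2l//.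
under eq_bigr do rewrite -nat1r mulrDr mulr1.
by rewrite big_split/= lerD// ?sum_pois_le1 ?sum_pois_size.
Qed.

Definition bino m s : R := 'C(m, s)%:R * p ^+ s * (1 - p) ^+ (m - s).

Lemma subE_bino (T : Type) (l : seq T) (F : nat -> R) n : (size l < n)%N ->
  subE N c l (fun S => F (size S)) = \sum_(0 <= s < n) bino (size l) s * F s.
Proof.
elim: l F n => [|w l IH] F n /=.
  case: n => // n _; rewrite big_nat_recl// big1 ?addr0.
    by rewrite /bino bin0 !mul1r.
  by move=> s _; rewrite /bino bin0n !mul0r.
case: n => // n; rewrite ltnS => ln.
rewrite (IH (fun s => F s.+1) n)// (IH F n.+1) ?(ltn_trans ln)// !mulr_sumr.
rewrite [in RHS]big_nat_recl// [X in _ + X]big_nat_recl// addrCA; congr (_ + _).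
  by rewrite /bino !bin0 !subn0 exprS !mulr1 !mul1r mulrA.
rewrite -big_split/=; apply: eq_bigr => s _; rewrite /bino binS natrD subSS -/p.
case: (ltnP s (size l)) => sl.
  by rewrite (_ : size l - s = (size l - s.+1).+1)%N ?exprS; [ring|rewrite subnSK].
by rewrite [in 'C(_, s.+1)]bin_small ?ltnS// !exprS; ring.
Qed.

(** Each of the [s] factors lies between [1 - ((N - m) + s) / N] and 1, and a product of numbers in
    [0,1] is at least 1 minus the sum of their defects. *)
Lemma ffact_lower m s : (m <= N)%N ->
  1 - s%:R * ((N - m)%:R + s%:R) / N%:R <= (m ^_ s)%:R / N%:R ^+ s :> R /\
  (m ^_ s)%:R / N%:R ^+ s <= 1 :> R.
Proof.
move=> mN; elim: s => [|s [IH1 IH2]].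
  by rewrite mul0r mul0r subr0 ffactn0 expr0 divr1.
rewrite ffactnSr natrM exprSr invfM mulrACA.
set A := _ / _ ^+ s in IH1 IH2 *.
have A0 : 0 <= A by rewrite divr_ge0// exprn_ge0// ltW.
set a : R := (m - s)%:R / N%:R.
have a0 : 0 <= a by rewrite divr_ge0// ltW.
have a1 : a <= 1 by rewrite ler_pdivrMr// mul1r ler_nat (leq_trans (leq_subr _ _)).
have a2 : 1 - ((N - m)%:R + s%:R) / N%:R <= a.
  rewrite ler_pdivlMr// mulrBl mul1r divfK ?gt_eqF// natrB//.
  have : m%:R <= (s%:R + (m - s)%:R) :> R by rewrite -natrD ler_nat -leq_subLR.
  by lra.
split; last by rewrite -[X in _ <= X]mul1r ler_pM.
set y : R := (_ + s%:R) / _ in a2.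
have y0 : 0 <= y by rewrite divr_ge0 ?addr_ge0// ltW.
apply: (@le_trans _ _ (A - y)); last by nra.
apply: (@le_trans _ _ (1 - s%:R * ((N - m)%:R + s%:R) / N%:R - y)); last by rewrite lerB.
rewrite -addrA lerD2l -opprD lerN2 /y -mulrDl ler_wpM2r ?invr_ge0 ?(ltW N0)//.
rewrite -nat1r; have : 0 <= s%:R :> R by []. have : 0 <= (N - m)%:R :> R by [].
by nra.
Qed.

(** From (1 - p) e^p >= (1 - p)(1 + p), raised to the power [n] by Bernoulli's inequality. *)
Lemma bernoulli_exp n : 1 - n%:R * p ^+ 2 <= (1 - p) ^+ n * expR (n%:R * p).
Proof.
have -> : (1 - p) ^+ n * expR (n%:R * p) = ((1 - p) * expR p) ^+ n.
  by rewrite mulrC exprMn mulrC expRM_natl.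
have h : 1 - p ^+ 2 <= (1 - p) * expR p.
  have -> : 1 - p ^+ 2 = (1 - p) * (1 + p) by ring.
  by rewrite ler_wpM2l ?subr_ge0// expR_ge1Dx.
have p2 : 0 <= 1 - p ^+ 2 by rewrite subr_ge0 exprn_ile1.
apply: (@le_trans _ _ ((1 - p ^+ 2) ^+ n)); last by rewrite lerXn2r ?nnegrE// (le_trans p2).
elim: n => [|n IH]; first by rewrite mul0r subr0.
rewrite [_ ^+ n.+1]exprS -nat1r; apply: le_trans (ler_wpM2l p2 IH) => //.
have : 0 <= n%:R * (p ^+ 2 * p ^+ 2) by rewrite !mulr_ge0 ?sqr_ge0.
by lra.
Qed.

Definition poisson_err m s : R := (c ^+ 2 + s%:R * ((N - m)%:R + s%:R)) / N%:R.

Lemma bino_pois m s : (m <= N)%N -> pois c s * (1 - poisson_err m s) <= bino m s.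
Proof.
move=> mN; have [h1 h2] := ffact_lower s mN.
set A := _ / N%:R ^+ s in h1 h2.
have A0 : 0 <= A by rewrite divr_ge0// exprn_ge0// ltW.
have NpE : N%:R * p = c by rewrite /p mulrC divfK// gt_eqF.
have := bernoulli_exp N; rewrite NpE.
have -> : N%:R * p ^+ 2 = c ^+ 2 / N%:R by rewrite expr2 mulrA NpE /p mulrA -expr2.
set y := c ^+ 2 / _ => hB.
have y0 : 0 <= y by rewrite divr_ge0 ?sqr_ge0// ltW.
have -> : bino m s = pois c s * (A * ((1 - p) ^+ (m - s) * expR c)).
  rewrite /bino /pois /A -bin_ffact natrM /p expr_div_n expRN.
  by field; rewrite !gt_eqF ?expR_gt0 ?exprn_gt0// ltr0n fact_gt0.
rewrite ler_wpM2l ?pois_ge0// /poisson_err mulrDl -/y.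
apply: (@le_trans _ _ (A * (1 - y))).
  move: h1; set x := _ / _ => h1; have -> : A * (1 - y) = A - A * y by ring.
  by nra.
rewrite ler_wpM2l//; apply: (le_trans hB); rewrite ler_wpM2r ?expR_ge0//.
apply: ler_wiXn2l; rewrite ?subr_ge0 ?lerBlDr ?lerDl//.
exact: leq_trans (leq_subr _ _) mN.
Qed.

(** For [F] with values in [[0, M]] the pointwise lower bound [bino_pois] is enough: its relative
    error is integrated against the Poisson law itself, whose moments are known. *)
Lemma subE_pois (T : Type) (l : seq T) (F : nat -> R) (M : R) n : (size l <= N)%N ->
  (forall s, 0 <= F s <= M) ->
  \sum_(0 <= s < n) pois c s * F s <=
    subE N c l (fun S => F (size S)) + M * ((c + 2 * c ^+ 2 + c * (N - size l)%:R) / N%:R).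
Proof.
move=> lN FM; set m := size l.
have M0 : 0 <= M by have /andP[+ /(le_trans _)] := FM 0%N => /[swap] h; exact: h.
have pF s : 0 <= pois c s * F s by rewrite mulr_ge0 ?pois_ge0//; have /andP[] := FM s.
(* The range is enlarged to contain the [n] Poisson terms as well as the whole binomial support. *)
apply: (@le_trans _ _ (\sum_(0 <= s < m.+1 + n) pois c s * F s)).
  rewrite [X in _ <= X](@big_cat_nat _ _ _ n)//= ?leq_addl// lerDl.
  by apply: sumr_ge0.
rewrite (@subE_bino _ _ _ (m.+1 + n)) ?leq_addr//.
apply: (@le_trans _ _ (\sum_(0 <= s < m.+1 + n)
   (bino m s * F s + pois c s * poisson_err m s * M))).
  apply: ler_sum => s _; have /andP[f0 f1] := FM s.
  rewrite -lerBlDr; apply: (@le_trans _ _ (pois c s * (1 - poisson_err m s) * F s)); last first.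
    by rewrite ler_wpM2r// bino_pois.
  have e0 : 0 <= poisson_err m s.
    by rewrite divr_ge0 ?(ltW N0)// addr_ge0 ?sqr_ge0// mulr_ge0// addr_ge0.
  have -> : pois c s * (1 - poisson_err m s) * F s =
     pois c s * F s - pois c s * poisson_err m s * F s by ring.
  by rewrite lerB// ler_wpM2l// mulr_ge0 ?pois_ge0.
rewrite big_split/= lerD2l -mulr_suml mulrC ler_wpM2l//.
rewrite (eq_bigr (fun s => (c ^+ 2 * pois c s + ((N - m)%:R * (pois c s * s%:R) +
  pois c s * s%:R ^+ 2)) / N%:R)); last by move=> s _; rewrite /poisson_err; ring.
rewrite -mulr_suml ler_wpM2r ?invr_ge0 ?(ltW N0)// !big_split/= -!mulr_sumr.
have h1 := sum_pois_le1 (m.+1 + n); have h2 := sum_pois_size (m.+1 + n).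
have h3 := sum_pois_size2 (m.+1 + n).
have h4 := ler_wpM2l (sqr_ge0 c) h1; have h5 := ler_wpM2l (ler0n R (N - m)) h2.
by move: h3 h4 h5; lra.
Qed.

End BinomialPoisson.

(** * Iterated integrals of Lipschitz functions on the cube *)

Section IteratedIntegral.
Variables (R : realType) (nu : probability R R).
Hypothesis nu01 : nu `[0%R, 1%R]%classic = 1%E.
Local Notation I01 := (`[0%R, 1%R]%classic : set R).

Definition lip1 (a : R) (psi : R -> R) :=
  forall x y, in01 x -> in01 y -> `|psi x - psi y| <= a * `|x - y|.

Lemma in01P (x : R) : I01 x <-> in01 x.
Proof. by rewrite /in01 set_itvE. Qed.

Let mI01 : measurable I01. Proof. exact: measurable_itv. Qed.

Lemma lip1_ge0 a psi : lip1 a psi -> 0 <= a.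
Proof.
move=> /(_ 1 0); rewrite subr0 normr1 mulr1 => h; apply: (le_trans (normr_ge0 _)).
by apply: h; rewrite /in01 ?lexx ?ler01.
Qed.

Lemma lip1_bound a psi x : lip1 a psi -> in01 x -> `|psi x - psi 0| <= a.
Proof.
move=> h x01; apply: le_trans (h _ 0 x01 _) _; first by rewrite /in01 lexx ler01.
rewrite subr0 -[X in _ <= X]mulr1 ler_wpM2l ?(lip1_ge0 h)//.
by have /andP[? ?] := x01; rewrite ger0_norm.
Qed.

(** Composed with the projection of the line onto [0,1], [psi] becomes continuous, and it is
    unchanged on [0,1]. *)
Lemma lip1_measurable a psi : lip1 a psi -> measurable_fun I01 psi.
Proof.
move=> h; have a0 := lip1_ge0 h.
pose clamp (x : R) := Num.max 0 (Num.min 1 x).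
have c01 x : in01 (clamp x).
  by rewrite /in01 /clamp le_max lexx/= ge_max ler01 ge_min lexx.
have cc (x y : R) : `|clamp x - clamp y| <= `|x - y|.
  rewrite /clamp /Num.max /Num.min; do !case: ifPn; rewrite -?leNgt => *;
  rewrite ler_norml; have := ler_norm (x - y); have := ler_norm (y - x);
  rewrite (distrC y x); move: `|x - y| => z ? ?; lra.
apply: (@eq_measurable_fun _ _ _ _ _ (psi \o clamp)).
  move=> x; rewrite inE => /in01P /andP[x0 x1] /=; congr psi.
  by rewrite /clamp min_r// max_r.
apply: measurable_funS (@measurableT _ _) (@subsetT _ _) _.
apply: continuous_measurable_fun => x; apply/cvgrPdist_le => /= e e0.
have a1 : 0 < a + 1 by rewrite ltr_wpDl.
near=> y.
apply: le_trans (h _ _ (c01 _) (c01 _)) _.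
apply: (@le_trans _ _ ((a + 1) * `|x - y|)).
  by apply: ler_pM => //; rewrite lerDl.
rewrite -ler_pdivlMl//.
near: y; apply/nbhs_normP; exists ((a + 1)^-1 * e); first by rewrite /= mulr_gt0 ?invr_gt0.
by move=> z /= /ltW.
Unshelve. all: by end_near. Qed.

Lemma lip1_integrable a psi : lip1 a psi -> nu.-integrable I01 (EFin \o psi).
Proof.
move=> h; apply: (@measurable_bounded_integrable _ _ _ nu psi I01 mI01).
- by rewrite /= nu01 ltry.
- exact: lip1_measurable h.
exists (`|psi 0| + a); split; first exact: num_real.
move=> M hM x /in01P x01; apply/ltW; apply: le_lt_trans hM.
rewrite -[psi x](subrK (psi 0)) addrC; apply: (le_trans (ler_normD _ _)).
by rewrite lerD2l; exact: lip1_bound.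
Qed.

Local Notation I psi := (\int[nu]_(x in I01) psi x).

Lemma Rint_le a a' psi psi' C : lip1 a psi -> lip1 a' psi' ->
  (forall x, in01 x -> psi x <= psi' x + C) -> I psi <= I psi' + C.
Proof.
move=> h h' le.
have -> : I psi' + C = I (fun x => psi' x + C).
  rewrite RintegralD//; [|exact: lip1_integrable h'|]; last first.
    by apply: (@lip1_integrable 0) => x y _ _; rewrite subrr normr0 mul0r.
  by rewrite Rintegral_cst// [X in fine X]nu01 mulr1.
apply: le_Rintegral => //; first exact: lip1_integrable h.
  apply: (@lip1_integrable a' (fun x => psi' x + C)) => x y x01 y01.
  by rewrite opprD addrACA subrr addr0; exact: h'.
Qed.

(** A real-valued form of [iint] on lists; the two agree on Lipschitz integrands by [iint_rint]. *)
Fixpoint rint (n : nat) (F : seq R -> R) : R :=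
  if n is n'.+1 then I (fun x => rint n' (fun s => F (x :: s))) else F [::].

Definition cube (n : nat) (x : seq R) := (size x == n) && all (@in01 R) x.

Lemma cube_cons n a x : cube n.+1 (a :: x) = in01 a && cube n x.
Proof. by rewrite /cube /= eqSS andbCA. Qed.

Definition lips (w : seq R) (F : seq R -> R) :=
  forall x y, cube (size w) x -> cube (size w) y -> `|F x - F y| <= wdist w x y.

Lemma wdistxx (w x : seq R) : wdist w x x = 0.
Proof. by elim: w x => [|a w IH] [|b x] //=; rewrite subrr normr0 mulr0 add0r. Qed.

Lemma lips_cons c w F x : lips (c :: w) F -> in01 x -> lips w (fun s => F (x :: s)).
Proof.
move=> h x01 s s' cs cs'; apply: le_trans (h _ _ _ _) _; rewrite /= ?cube_cons ?x01//.
by rewrite subrr normr0 mulr0 add0r.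
Qed.

(** Monotonicity of the outer integral needs the inner one to be integrable in [x]. The inner one is
    Lipschitz in [x] by the induction hypothesis, taken with [C] equal to [b] times the distance of
    the two points. *)
Lemma rint_le n w w' F F' C : size w = n -> size w' = n -> lips w F -> lips w' F' ->
  (forall x, cube n x -> F x <= F' x + C) -> rint n F <= rint n F' + C.
Proof.
elim: n w w' F F' C => [|n IH] [|c w] [|c' w'] F F' C //= => [_ _ _ _|[sw] [sw'] h h' le].
  exact.
have L1 v b G : size v = n -> lips (b :: v) G -> lip1 b (fun x => rint n (fun s => G (x :: s))).
  move=> sv hG.
  have H x y : in01 x -> in01 y -> rint n (fun s => G (x :: s)) <=
      rint n (fun s => G (y :: s)) + b * `|x - y|.
    move=> x01 y01; apply: (IH v v) => //; try exact: lips_cons hG _.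
    move=> s cs; rewrite -lerBlDl; apply: le_trans (ler_norm _) _.
    apply: le_trans (hG _ _ _ _) _; rewrite /= ?cube_cons ?sv ?x01 ?y01 ?cs//.
    by rewrite wdistxx addr0.
  move=> x y x01 y01; rewrite ler_norml; have := H _ _ x01 y01; have := H _ _ y01 x01.
  by rewrite (distrC y x); move: (rint _ _) (rint _ _) => u v'; lra.
apply: (Rint_le (L1 _ _ _ sw h) (L1 _ _ _ sw' h')) => x x01.
apply: (IH w w') => //; try (exact: lips_cons h _ || exact: lips_cons h' _).
by move=> s cs; apply: le; rewrite cube_cons x01.
Qed.

Lemma rint_lip1 w b F : lips (b :: w) F ->
  lip1 b (fun x => rint (size w) (fun s => F (x :: s))).
Proof.
move=> hF.
have H x y : in01 x -> in01 y -> rint (size w) (fun s => F (x :: s)) <=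
    rint (size w) (fun s => F (y :: s)) + b * `|x - y|.
  move=> x01 y01; apply: (@rint_le _ w w) => //; try exact: lips_cons hF _.
  move=> s cs; rewrite -lerBlDl; apply: le_trans (ler_norm _) _.
  apply: le_trans (hF _ _ _ _) _; rewrite /= ?cube_cons ?x01 ?y01 ?cs//.
  by rewrite wdistxx addr0.
move=> x y x01 y01; rewrite ler_norml; have := H _ _ x01 y01; have := H _ _ y01 x01.
by rewrite (distrC y x); move: (rint _ _) (rint _ _) => u v'; lra.
Qed.

Lemma eq_rint w F F' : lips w F -> (forall x, cube (size w) x -> F x = F' x) ->
  rint (size w) F = rint (size w) F'.
Proof.
move=> h e; have h' : lips w F' by move=> x y cx cy; rewrite -!e//; exact: h.
apply/eqP; rewrite eq_le -[X in _ <= X]addr0 -[X in _ && (_ <= X)]addr0.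
by rewrite !(@rint_le _ w w)// => x cx; rewrite addr0 e.
Qed.

Lemma rint_cst n a : rint n (fun=> a) = a.
Proof. by elim: n => //= n ->; rewrite Rintegral_cst// [X in fine X]nu01 mulr1. Qed.

Lemma rintD w w' F F' : size w = size w' -> lips w F -> lips w' F' ->
  rint (size w) (fun s => F s + F' s) = rint (size w) F + rint (size w) F'.
Proof.
elim: w w' F F' => [|c w IH] [|c' w'] F F' //= [sw] h h'.
rewrite -RintegralD//.
- apply: eq_Rintegral => x; rewrite inE => /in01P x01.
  by apply: (IH w') => //; (exact: lips_cons h _ || exact: lips_cons h' _).
- exact: lip1_integrable (rint_lip1 h).
- by rewrite sw; exact: lip1_integrable (rint_lip1 h').
Qed.

Lemma rintZ w a F : lips w F -> rint (size w) (fun s => a * F s) = a * rint (size w) F.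
Proof.
elim: w F => [|c w IH] F //= h; rewrite -RintegralZl//.
  apply: eq_Rintegral => x; rewrite inE => /in01P x01.
  by apply: IH; exact: lips_cons h _.
exact: lip1_integrable (rint_lip1 h).
Qed.

Lemma rint_cat m n F : rint (m + n) F = rint m (fun xs => rint n (fun ys => F (xs ++ ys))).
Proof. by elim: m F => //= m IH F; apply: eq_Rintegral => x _; exact: IH. Qed.

Lemma iint_rint w F : lips w F ->
  iint nu (fun x : (size w).-tuple R => (F x)%:E) = (rint (size w) F)%:E.
Proof.
elim: w F => [|c w IH] F h //=.
rewrite /Rintegral fineK; last first.
  by apply: integrable_fin_num => //; exact: lip1_integrable (rint_lip1 h).
apply: eq_integral => x; rewrite inE => /in01P x01.
by rewrite -(IH (fun s => F (x :: s)))//; exact: lips_cons h _.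
Qed.

End IteratedIntegral.

(** * Integrals of nonnegative functions without measurability *)

Section LowerIntegral.
Local Open Scope ereal_scope.
Variables (R : realType).
Import HBNNSimple.

Lemma ereal_sup_superadditive (A B : set (\bar R)) c : A 0 -> B 0 ->
  (forall u v, A u -> B v -> u + v <= c) -> ereal_sup A + ereal_sup B <= c.
Proof.
move=> A0 B0 h.
have sA0 : 0 <= ereal_sup A by exact: ereal_sup_ubound.
have sB0 : 0 <= ereal_sup B by exact: ereal_sup_ubound.
have c0 : 0 <= c by have := h _ _ A0 B0; rewrite adde0.
have [->|coo] := eqVneq c +oo; first exact: leey.
have cfin : c \is a fin_num by rewrite ge0_fin_numE// ltey.
have sBc : ereal_sup B <= c.
  by apply: ge_ereal_sup => v Bv; rewrite -[v]add0e h.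
have sBfin : ereal_sup B \is a fin_num.
  by rewrite ge0_fin_numE// (le_lt_trans sBc)// ltey.
rewrite -leeBrDr//; apply: ge_ereal_sup => u Au; rewrite leeBrDr//.
have uc : u <= c by rewrite -[u]adde0 h.
have [u0|u0] := leP 0 u; last first.
  by rewrite (le_trans _ sBc)// -[X in _ <= X]add0e leeD2r// ltW.
have ufin : u \is a fin_num by rewrite ge0_fin_numE// (le_lt_trans uc)// ltey.
by rewrite -leeBrDl//; apply: ge_ereal_sup => v Bv; rewrite leeBrDl// h.
Qed.

Variables (d : measure_display) (T : measurableType d).
Variables (mu : {measure set T -> \bar R}) (D : set T).

(* No measurability: for nonnegative functions the integral is the supremum of the integrals
   of the simple functions below, which is superadditive. *)
Lemma ge0_integral_superadditive (f g k : T -> \bar R) :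
  (forall x, D x -> 0 <= f x) -> (forall x, D x -> 0 <= g x) ->
  (forall x, D x -> f x + g x <= k x) ->
  \int[mu]_(x in D) f x + \int[mu]_(x in D) g x <= \int[mu]_(x in D) k x.
Proof.
move=> f0 g0 fgk; rewrite !ge0_integralE//; last first.
  by move=> x Dx; apply: le_trans (fgk x Dx); rewrite adde_ge0 ?f0 ?g0.
apply: ereal_sup_superadditive.
- exists nnsfun0; last exact: sintegral0.
  by move=> x /=; rewrite /patch; case: ifPn => // /set_mem /f0.
- exists nnsfun0; last exact: sintegral0.
  by move=> x /=; rewrite /patch; case: ifPn => // /set_mem /g0.
move=> _ _ [u hu <-] [v hv <-]; rewrite -sintegralD; apply: ereal_sup_ubound.
exists (add_nnsfun u v) => //= x.
have := leeD (hu x) (hv x); rewrite /= -EFinD => /le_trans; apply.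
by rewrite /patch; case: ifPn => [/set_mem|_]; [exact: fgk|rewrite adde0].
Qed.

Lemma ge0_integral_sum_superadditive (J : Type) (r : seq J) (f : J -> T -> \bar R) (k : T -> \bar R) :
  (forall j x, D x -> 0 <= f j x) ->
  (forall x, D x -> \sum_(j <- r) f j x <= k x) ->
  \sum_(j <- r) \int[mu]_(x in D) f j x <= \int[mu]_(x in D) k x.
Proof.
move=> f0 le.
have sum_le : \sum_(j <- r) \int[mu]_(x in D) f j x <= \int[mu]_(x in D) \sum_(j <- r) f j x.
  elim: r {le} => [|j r IH]; first by rewrite big_nil integral_ge0// => x _; rewrite big_nil.
  rewrite big_cons; apply: le_trans (leeD2l _ IH) _.
  apply: ge0_integral_superadditive => [x|x Dx|x _]; first exact: f0.
    by apply: sume_ge0 => i _; exact: f0.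
  by rewrite big_cons.
apply: le_trans sum_le _.
have := @ge0_integral_superadditive (fun x => \sum_(j <- r) f j x) (cst 0) k.
rewrite integral0 adde0; apply => // x Dx; last by rewrite adde0; exact: le.
by apply: sume_ge0 => i _; exact: f0.
Qed.

End LowerIntegral.

Section IteratedLowerIntegral.
Variables (R : realType) (nu : probability R R).

Lemma iint_ge0 n (f : n.-tuple R -> \bar R) :
  (forall x : n.-tuple R, all (@in01 R) x -> (0 <= f x)%E) -> (0 <= iint nu f)%E.
Proof.
elim: n f => [|n IH] f f0 /=; first exact: f0.
apply: integral_ge0 => x /in01P x01; apply: IH => s s01; apply: f0.
by rewrite /= x01.
Qed.

(** It serves for indicators of level sets along [Phi], whose sum lies below a Lipschitz
    function. *)
Lemma iint_sum_superadditive (J : Type) (r : seq J) n (f : J -> n.-tuple R -> \bar R) k :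
  (forall j (x : n.-tuple R), all (@in01 R) x -> (0 <= f j x)%E) ->
  (forall x : n.-tuple R, all (@in01 R) x -> (\sum_(j <- r) f j x <= k x)%E) ->
  (\sum_(j <- r) iint nu (f j) <= iint nu k)%E.
Proof.
elim: n f k => [|n IH] f k f0 le /=; first exact: le.
apply: ge0_integral_sum_superadditive => [j x /in01P x01|x /in01P x01].
  by apply: iint_ge0 => s s01; apply: f0; rewrite /= x01.
by apply: IH => [j|] s s01; [apply: f0|apply: le]; rewrite /= x01.
Qed.

End IteratedLowerIntegral.

(** * The operator [Phi] in closed form *)

Section ProdE.
Variable R : realType.
Implicit Type x : seq R.

Lemma prodE_seqE n (x : n.-tuple R) (F : seq bool -> R) :
  prodE x (fun s => F s) = seqE x F.
Proof.
elim: n x F => [|n IH] x F.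
  rewrite tuple0 /prodE (big_pred1 [tuple]) => [|s]; last by apply/esym/eqP; apply: val_inj; case: s => -[].
  by rewrite big_ord0 mul1r.
case/tupleP: x => a x /=; rewrite -(IH x (fun s => F (true :: s))) -(IH x (fun s => F (false :: s))).
rewrite /prodE (reindex (fun p : bool * n.-tuple bool => cons_tuple p.1 p.2))/=; last first.
  exists (fun s : n.+1.-tuple bool => (thead s, [tuple of behead s])) => [[b s] _|s _] /=.
    by congr pair; exact: val_inj.
  by case/tupleP: s => b s; apply: val_inj.
rewrite -(pair_bigA _ (fun b (s : n.-tuple bool) => (\prod_(i < n.+1)
  bern_w (tnth (cons_tuple a x) i) (tnth (cons_tuple b s) i)) * F (b :: s)))/=.
rewrite big_bool/= !mulr_sumr; congr (_ + _); apply: eq_bigr => s _;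
  rewrite big_ord_recl !tnth0 /= -mulrA; congr (_ * (_ * _));
  by apply: eq_bigr => i _; rewrite !tnthS.
Qed.

Lemma seqE_prod x (u : R) :
  seqE x (fun s => \prod_(b <- s) (if b then u else 1)) = \prod_(m <- x) (1 - (1 - u) * m).
Proof.
(* The extra factor [a] carries the contribution of the spins already read. *)
have H y a : seqE y (fun s => a * \prod_(b <- s) (if b then u else 1)) =
    a * \prod_(m <- y) (1 - (1 - u) * m).
  elim: y a => [|m y IH] a /=; first by rewrite !big_nil.
  have e b : seqE y (fun s => a * \prod_(b' <- b :: s) (if b' then u else 1)) =
      seqE y (fun s => (a * if b then u else 1) * \prod_(b' <- s) (if b' then u else 1)).
    by congr seqE; apply/funext => s; rewrite big_cons mulrA.
  by rewrite !e !IH big_cons; ring.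
have := H x 1; rewrite mul1r => <-.
by congr seqE; apply/funext => s; rewrite mul1r.
Qed.

(** By independence the expectation of exp(h - b sum) factorises into z = [odds t (expR h) x], and
    (1 + 1/z)^-1 = z / (1 + z). *)
Lemma Phi_phi (b h t : R) n (x : n.-tuple R) : t ^+ 2 = expR (- b) ->
  0 < \prod_(m <- x) (1 - (1 - t ^+ 2) * m) -> Phi b h x = phi t (expR h) x.
Proof.
move=> tb; rewrite /Phi /phi /odds => P0.
have -> : prodE x (fun s => expR (h - b * \sum_(i < n) (tnth s i)%:R)) =
    expR h * \prod_(m <- x) (1 - (1 - t ^+ 2) * m).
  rewrite -seqE_prod -prodE_seqE /prodE mulr_sumr; apply: eq_bigr => s _.
  rewrite mulrCA; congr (_ * _); rewrite expRD; congr (_ * _).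
  rewrite big_tuple -mulNr mulr_sumr expR_sum; apply: eq_bigr => i _.
  by case: (tnth s i); rewrite ?mulr1 ?tb// mulr0 expR0.
have e0 : 0 < expR h * \prod_(m <- x) (1 - (1 - t ^+ 2) * m) by rewrite mulr_gt0 ?expR_gt0.
move: e0; set z := _ * _ => z0.
by field; rewrite !gt_eqF// addr_gt0.
Qed.

End ProdE.

Lemma odds_prod_gt0 (R : realType) (t : R) (ms : seq R) : 0 < t -> t <= 1 -> all (@in01 R) ms ->
  0 < \prod_(m <- ms) (1 - (1 - t ^+ 2) * m).
Proof.
move=> t0 t1; elim: ms => [|m ms IH] /=; first by rewrite big_nil.
case/andP=> m01 /IH h; rewrite big_cons mulr_gt0//.
by have /andP[+ _] := odds_factor t0 t1 m01; apply: lt_le_trans; rewrite exprn_gt0.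
Qed.

(** The sum counts the integers from 1 to [m] that are at most [y]. A function into [[0, m]] is thus
    approximated from below, within 1, by indicators of level sets. *)
Lemma layer_cake (R : realType) m (y : R) : 0 <= y ->
  \sum_(j < m) ((j.+1%:R : R) <= y)%R%:R <= y /\
  (y <= m%:R -> y <= 1 + \sum_(j < m) ((j.+1%:R : R) <= y)%R%:R).
Proof.
move=> y0; elim: m => [|m [IH1 IH2]].
  by rewrite big_ord0; split=> // y1; rewrite addr0 (le_trans y1).
have sm : \sum_(j < m) ((j.+1%:R : R) <= y)%R%:R <= m%:R :> R.
  have -> : m%:R = \sum_(j < m) 1 :> R by rewrite sumr_const card_ord.
  by apply: ler_sum => j _; rewrite lern1 leq_b1.
rewrite big_ord_recr/=; split.
  case: (lerP m.+1%:R y) => h; rewrite ?addr0//.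
  by apply: le_trans h; rewrite -natr1 lerD2r.
move=> ym; case: (lerP y m%:R) => h; first by rewrite (le_trans (IH2 h))// lerD2l lerDl.
have -> : \sum_(j < m) ((j.+1%:R : R) <= y)%R%:R = m%:R :> R.
  have -> : m%:R = \sum_(j < m) 1 :> R by rewrite sumr_const card_ord.
  apply: eq_bigr => j _; rewrite (_ : _ <= _) //.
  by apply: le_trans (ltW h); rewrite ler_nat.
by rewrite addrA nat1r (le_trans ym)// lerDl.
Qed.

(** * The fixpoint equation as an inequality for Lipschitz functions *)

Section FixpointInequality.
Variables (R : realType) (nu : probability R R) (b h c t : R) (N : nat).
Hypotheses (t_gt0 : 0 < t) (t_le1 : t <= 1) (tb : t ^+ 2 = expR (- b)).
Hypotheses (c_ge0 : 0 <= c) (N_gt0 : (0 < N)%N) (c_le : c <= N%:R).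
Hypothesis fp : is_T_fixpoint b h c nu.
Local Notation I01 := (`[0%R, 1%R]%classic : set R).
Local Notation L := (lipc t).
Local Notation Phi01 ys := (phi t (expR h) ys).

Let nu01 : nu I01 = 1%E. Proof. exact: fp.1. Qed.

Lemma wdistZ (a : R) w x y : wdist (map ( *%R a) w) x y = a * wdist w x y.
Proof. by elim: w x y => [|u w IH] [|e x] [|d y] //=; rewrite ?mulr0// IH mulrDr mulrA. Qed.

Lemma Phi01_in01 ys : all (@in01 R) ys -> in01 (Phi01 ys).
Proof. by move=> h01; apply: phi01 => //; exact: expR_ge0. Qed.

Lemma lips_phi a psi n : lip1 a psi -> lips (nseq n (a * L)) (fun ys => psi (Phi01 ys)).
Proof.
move=> hp x y; rewrite size_nseq => /andP[/eqP sx x01] /andP[/eqP sy y01].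
apply: le_trans (hp _ _ (Phi01_in01 x01) (Phi01_in01 y01)) _.
have -> : nseq n (a * L) = map ( *%R a) (nseq n L) by rewrite map_nseq.
rewrite wdistZ ler_wpM2l ?(lip1_ge0 hp)// -sx.
by apply: phi_lip => //; rewrite ?sx ?sy// expR_ge0.
Qed.

Let rphi psi s := rint nu s (fun ys => psi (Phi01 ys)).

(** As the fixpoint equation concerns sets, [psi] is replaced by its level sets [A j], at a loss of
    1. For each Poisson value [s] the indicators along [Phi] add up to at most [psi] along [phi],
    and [subE_pois] then turns Poisson into binomial. *)
Lemma fixpoint_le_normalized a psi m (T : Type) (l : seq T) : lip1 a psi ->
  (forall x, in01 x -> 0 <= psi x <= m%:R) -> (size l <= N)%N ->
  \int[nu]_(x in I01) psi x <= 1 + (subE N c l (fun S => rphi psi (size S)) +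
     m%:R * ((c + 2 * c ^+ 2 + c * (N - size l)%:R) / N%:R)).
Proof.
move=> hp p01 lN; set B := subE _ _ _ _ + _.
have mI : measurable I01 by exact: measurable_itv.
have mp := lip1_measurable hp.
pose A (j : 'I_m) : set R := (I01 `&` psi @^-1` `[j.+1%:R, +oo[)%classic.
have mA j : measurable (A j) by apply: mp => //; exact: measurable_itv.
have Ai j x : in01 x -> \1_(A j) x = ((j.+1%:R : R) <= psi x)%R%:R :> R.
  move=> x01; rewrite indicE; congr (nat_of_bool _)%:R.
  apply/idP/idP => [|h1]; first by rewrite inE => -[_] /=; rewrite in_itv/= andbT.
  by rewrite inE; split; [exact/in01P|rewrite /= in_itv/= andbT].
have sA : (\sum_(j < m) nu (A j) <= B%:E)%E.
  rewrite (eq_bigr (fun j => Tmap b h c nu (A j))) => [|j _]; last by exact: fp.2.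
  have ge0 j s : (0 <= iint nu (fun x : s.-tuple R => (\1_(A j) (Phi b h x))%:E))%E.
    by apply: iint_ge0 => x _; rewrite lee_fin indicE.
  rewrite /Tmap -nneseries_sum => [|j s _]; last by rewrite mule_ge0// lee_fin pois_ge0.
  apply: lime_le.
    apply: is_cvg_nneseries => s _ _; apply: sume_ge0 => j _.
    by rewrite mule_ge0// lee_fin pois_ge0.
  apply: nearW => n.
  apply: (@le_trans _ _ (\sum_(0 <= s < n) pois c s * rphi psi s)%:E); last first.
    rewrite lee_fin; apply: subE_pois => // s.
    have hs := @lips_phi a psi s hp.
    have cst (r : R) : lips (nseq s 0) (fun=> r).
      move=> x y _ _; rewrite subrr normr0.
      by elim: s x y {hs} => [|s IH] [|u x] [|v y] //=; rewrite mul0r add0r.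
    have p01' ys : all (@in01 R) ys -> 0 <= psi (Phi01 ys) <= m%:R by move=> /Phi01_in01 /p01.
    apply/andP; split; rewrite -[X in _ <= X]addr0.
      rewrite -[X in X <= _](rint_cst nu01 s); apply: rint_le (cst _) hs _; rewrite ?size_nseq//.
      by move=> ys /andP[_ /p01'/andP[? _]]; rewrite addr0.
    rewrite -[X in _ <= X + _](rint_cst nu01 s); apply: rint_le hs (cst _) _; rewrite ?size_nseq//.
    by move=> ys /andP[_ /p01'/andP[_ ?]]; rewrite addr0.
  rewrite -sumEFin; apply: lee_sum => s _.
  rewrite -ge0_sume_distrr// [X in (_ <= X)%E]EFinM lee_wpmul2l ?lee_fin ?pois_ge0//.
  have := iint_rint nu01 (@lips_phi a psi s hp); rewrite size_nseq => <-.
  apply: iint_sum_superadditive => [j|] x x01; first by rewrite lee_fin indicE.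
  rewrite sumEFin lee_fin (Phi_phi _ tb); last exact: odds_prod_gt0.
  have /andP[y0 _] := p01 _ (Phi01_in01 x01).
  apply: le_trans (layer_cake m y0).1.
  by apply: ler_sum => j _; rewrite Ai//; exact: Phi01_in01.
rewrite -lee_fin fineK; last exact: integrable_fin_num (lip1_integrable nu01 hp).
apply: (@le_trans _ _ (\int[nu]_(x in I01) (1 + \sum_(j < m) (\1_(A j) x)%:E)))%E.
  apply: ge0_le_integral => //.
  - by move=> x /in01P /p01 /andP[? _]; rewrite lee_fin.
  - exact/measurable_EFinP.
  - apply: emeasurable_funD => //; apply: emeasurable_sum => j.
    by apply/measurable_EFinP; exact: measurable_indic.
  move=> x /in01P x01; rewrite sumEFin -EFinD lee_fin.
  have /andP[y0 ym] := p01 _ x01; apply: le_trans ((layer_cake m y0).2 ym) _.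
  by rewrite lerD2l; apply: ler_sum => j _; rewrite Ai.
rewrite ge0_integralD//; last 2 first.
- by move=> x _; apply: sume_ge0 => j _; rewrite lee_fin indicE.
- apply: emeasurable_sum => j; by apply/measurable_EFinP; exact: measurable_indic.
rewrite integral_cst//= nu01 mule1 EFinD leeD2l//.
rewrite (ge0_integral_sum _ mI) => [|j|j x _]; last 2 first.
- by apply/measurable_EFinP; exact: measurable_indic.
- by rewrite lee_fin indicE.
apply: le_trans sA; apply: lee_sum => j _; rewrite integral_indic//.
by apply: le_measure; rewrite ?inE//; exact: measurableI.
Qed.

Lemma rint_affine w F k d : lips w F ->
  rint nu (size w) (fun s => k * (F s + d)) = k * (rint nu (size w) F + d).
Proof.
move=> hF.
have hd : lips w (fun s => F s + d) by move=> x y cx cy; rewrite opprD addrACA subrr addr0; exact: hF.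
have hc : lips w (fun=> d).
  move=> x y cx cy; rewrite subrr normr0; apply: le_trans (hF _ _ cx cy).
  exact: normr_ge0.
by rewrite (rintZ nu01 k hd) (rintD nu01 (erefl _) hF hc) rint_cst.
Qed.

Definition fixpoint_err n : R := (c + 2 * c ^+ 2 + c * (N - n)%:R) / N%:R.

(** Blowing [psi] up affinely before the layer-cake step makes the loss of 1 negligible: undone, it
    becomes [k^-1]. The values of [psi] lie within [a] of [psi 0], hence the factor [2 * a]. *)
Lemma fixpoint_le a psi (T : Type) (l : seq T) : lip1 a psi -> (size l <= N)%N ->
  \int[nu]_(x in I01) psi x <=
    subE N c l (fun S => rphi psi (size S)) + 2 * a * fixpoint_err (size l).
Proof.
move=> hp lN; have a0 := lip1_ge0 hp; set err := fixpoint_err _.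
have err0 : 0 <= err by rewrite divr_ge0// !addr_ge0// mulr_ge0// sqr_ge0.
apply/ler_addgt0Pr => e e0.
(* Two losses must add up to at most [e]: [k^-1 <= del] from the layers, and [2 * del * err] from
   widening the range by [2 * del]. The widening keeps [M] positive when [a] is 0. *)
pose del := e / (1 + 2 * err).
have s0 : 0 < 1 + 2 * err by rewrite ltr_pwDl// mulr_ge0.
have del0 : 0 < del by rewrite divr_gt0.
pose M := 2 * (a + del).
have M0 : 0 < M by rewrite mulr_gt0// ltr_wpDl.
pose m := (Num.truncn (M / del)).+1.
have mM : M / del < m%:R by exact: truncnS_gt.
have m0 : 0 < m%:R :> R by rewrite ltr0n.
pose k := m%:R / M; pose d := a + del - psi 0.
have k0 : 0 < k by rewrite divr_gt0.
have kM : k * M = m%:R by rewrite /k divfK ?gt_eqF.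
have hp' : lip1 (k * a) (fun x => k * (psi x + d)).
  move=> x y x01 y01; rewrite -mulrBr normrM gtr0_norm// -[X in _ <= X]mulrA ler_wpM2l ?(ltW k0)//.
  by rewrite opprD addrACA subrr addr0; exact: hp.
have bd x : in01 x -> 0 <= k * (psi x + d) <= m%:R.
  move=> x01; have := lip1_bound hp x01; rewrite ler_norml => /andP[h1 h2].
  apply/andP; split; first by rewrite mulr_ge0 ?(ltW k0)// /d; lra.
  by rewrite -kM ler_wpM2l ?(ltW k0)// /d /M; lra.
have := @fixpoint_le_normalized _ _ m _ l hp' bd lN; rewrite -/(fixpoint_err _) -/err.
have hl : lips [:: a] (fun s => psi (head 0 s)).
  move=> [|x [|? ?]] [|y [|? ?]] //=; rewrite !cube_cons addr0 => /andP[x01 _] /andP[y01 _].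
  exact: hp.
have := rint_affine k d hl; rewrite /= => ->.
rewrite (@eq_subE _ _ _ _ _ _ (fun S => k * (rphi psi (size S) + d))); last first.
  by move=> S; have := rint_affine k d (@lips_phi a psi (size S) hp); rewrite size_nseq.
rewrite subEZ subED subE_cst -kM; set X := Rintegral _ _ _; set Y := subE _ _ _ _.
move=> H; have {}H : k * X <= k * (Y + k^-1 + M * err).
  by rewrite !mulrDr mulfV ?gt_eqF//; move: H; rewrite !mulrDr !mulrA; lra.
rewrite ler_pM2l// in H; apply: (le_trans H).
have k1 : k^-1 <= del by rewrite /k invf_div ler_pdivrMr// mulrC -ler_pdivrMr// ltW.
have eE : e = del + 2 * del * err by rewrite /del; field; rewrite gt_eqF.
by rewrite [X in _ <= _ + X]eE /M; move: (k^-1) (del) k1 => u v uv; lra.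
Qed.

End FixpointInequality.

(** * Arithmetic of the accumulated error *)

Section ErrorBudget.
Variables (R : realType) (L g K : R).
Hypotheses (L0 : 0 <= L) (g0 : 0 <= g) (Lg : L * g <= 1 / 14) (Lg2 : L * g ^+ 2 <= 1 / 28).
Implicit Types k r d m q s : R.

(* Error, in units of [a / N], when [k] entries have Lipschitz constant [a] and [r] entries have [a * L],
   and [d] vertices have been deleted: the first summand is the cost of replacing the [k] entries, the
   second one that of restarting with the expected [x] new entries. *)
Definition budget k r d : R :=
  let x := r + k * g in
  k * K * (1 + d + k + r + k * g) +
  L * (2 * K * (1 + g) * x + 2 * K * (1 + g) * (x ^+ 2 + k * g) + 2 * K * x * (d + k)).

(** Coefficients in [s] of the budget that remains once an old entry has been traded for [s] new
    ones and one more vertex is deleted. *)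
Definition budget_c0 k r d : R := let y := r + k * g in
  k * K * (2 + d + k + y) +
  L * (2 * K * (1 + g) * y + 2 * K * (1 + g) * (y ^+ 2 + k * g) + 2 * K * y * (d + 1 + k)).
Definition budget_c1 k r d : R := let y := r + k * g in
  k * K + L * (2 * K * (1 + g) + 4 * K * (1 + g) * y + 2 * K * (d + 1 + k)).
Definition budget_c2 : R := L * (2 * K * (1 + g)).

Lemma budget_poly k r d s : budget k (r + s) (d + 1) =
  budget_c0 k r d + (budget_c1 k r d * s + budget_c2 * s ^+ 2).
Proof. rewrite /budget /budget_c0 /budget_c1 /budget_c2 /=; ring. Qed.

Hypothesis K0 : 0 <= K.

(** Here [m] and [q] stand for the first two moments of the number of new vertices. The slack is an
    explicit sum: [Kgm] comes from the first summand of [budget], and [H1], [H2], [H3] from the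
    three terms multiplied by [L]. *)
Lemma budget_step k r d m q : 0 <= k -> 0 <= r -> 0 <= d -> 0 <= m <= g -> q <= m + m ^+ 2 ->
  budget_c0 k r d + (budget_c1 k r d * m + budget_c2 * q) + K * (1 + d + (k + 1) + r)
    <= budget (k + 1) r d.
Proof.
move=> k0 r0 d0 /andP[m0 mg] qm; set y := r + k * g.
have y0 : 0 <= y by rewrite addr_ge0// mulr_ge0.
have gm : 0 <= g - m by rewrite subr_ge0.
have gq : 0 <= g ^+ 2 + g - q.
  by rewrite subr_ge0 (le_trans qm)// addrC lerD// lerXn2r// nnegrE.
have Kgm : 0 <= K * (g * (2 * k + 1) - k * m) by rewrite mulr_ge0//; nra.
have H1 : 0 <= K * (1 + g) * (g - m) by rewrite !mulr_ge0// addr_ge0.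
have H2 : 0 <= K * (1 + g) * (2 * y * (g - m) + (g ^+ 2 + g - q)).
  by rewrite mulr_ge0 ?mulr_ge0// addr_ge0// !mulr_ge0.
have H3 : 0 <= K * (g - m) * (d + k + 1) by rewrite !mulr_ge0// !addr_ge0.
have H := mulr_ge0 L0 (addr_ge0 (addr_ge0 H1 H2) H3).
rewrite -subr_ge0; apply: (le_trans (addr_ge0 Kgm (mulr_ge0 (ler0n R 2) H))).
rewrite le_eqVlt; apply/orP; left; apply/eqP.
by rewrite /budget /budget_c0 /budget_c1 /budget_c2 /= /y; ring.
Qed.

(** This is where the geometric series converges: owing to the factors 2 in the second summand of
    [budget], replacing the [r] entries uses about half of the right side, and smallness of [L * g]
    and [L * g ^+ 2] lets the other half pay for all later restarts. *)
Lemma budget_relabel r d : 0 <= r -> 0 <= d -> L * budget r 0 d <= budget 0 r d.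
Proof.
move=> r0 d0; have K1 : 0 <= K * (1 + g) by rewrite mulr_ge0// addr_ge0.
have rd : 0 <= r * d by rewrite mulr_ge0.
have r2 : 0 <= r ^+ 2 by rewrite sqr_ge0.
rewrite -subr_ge0 [X in 0 <= X](_ : _ = L * (
  r * (K * (1 + g) * 2 * (1 - 2 * (L * g)) - K) +
  r ^+ 2 * (K * (1 + g) * (1 - 2 * (L * g ^+ 2)) - 2 * K * (L * g)) +
  r * d * (K - 2 * K * (L * g)))); last by rewrite /budget /=; ring.
have Kg : 0 <= K * g by rewrite mulr_ge0.
have h1 : K * (1 + g) * (L * g) <= K * (1 + g) * (1 / 14) by rewrite ler_wpM2l.
have h2 : K * (1 + g) * (L * g ^+ 2) <= K * (1 + g) * (1 / 28) by rewrite ler_wpM2l.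
have h3 : K * (L * g) <= K * (1 / 14) by rewrite ler_wpM2l.
apply: mulr_ge0 => //; do 2?[apply: addr_ge0]; apply: mulr_ge0 => //.
- have -> : K * (1 + g) * 2 * (1 - 2 * (L * g)) - K =
    2 * (K * (1 + g)) - 4 * (K * (1 + g) * (L * g)) - K by ring.
  by move: (K * (1 + g) * (L * g)) h1 => u h1; lra.
- have -> : K * (1 + g) * (1 - 2 * (L * g ^+ 2)) - 2 * K * (L * g) =
    K * (1 + g) - 2 * (K * (1 + g) * (L * g ^+ 2)) - 2 * (K * (L * g)) by ring.
  by move: (K * (1 + g) * (L * g ^+ 2)) (K * (L * g)) h2 h3 => u v h2 h3; lra.
have -> : K - 2 * K * (L * g) = K - 2 * (K * (L * g)) by ring.
by have := K0; move: (K * (L * g)) h3 => u h3 K0'; lra.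
Qed.

Lemma budget_start k : 1 <= k -> budget k 0 0 <= 3 * K * (1 + g) ^+ 2 * k ^+ 2.
Proof.
move=> k1; have k0 : 0 <= k by apply: le_trans k1.
have kk : k <= k ^+ 2 by rewrite expr2 ler_peMl.
have kk0 : 0 <= k ^+ 2 by rewrite sqr_ge0.
have Lg0 : 0 <= L * g by rewrite mulr_ge0.
have K1 : 0 <= K * (1 + g) by rewrite mulr_ge0// addr_ge0.
have K2 : 0 <= K * (1 + g) ^+ 2 by rewrite mulr_ge0// sqr_ge0.
have Kg : 0 <= K * g by rewrite mulr_ge0.
rewrite /budget add0r !addr0 !add0r.
rewrite [X in X <= _](_ : _ = K * k + K * (1 + g) * k ^+ 2 +
  (L * g) * (2 * (K * (1 + g)) * k + 2 * (K * (1 + g)) * (k ^+ 2 * g + k) + 2 * K * k ^+ 2)); last by ring.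
set Q := (X in _ + (L * g) * X).
have Q0 : 0 <= Q by rewrite /Q !addr_ge0 ?mulr_ge0// addr_ge0// mulr_ge0.
have h1 : L * g * Q <= 1 / 14 * Q by rewrite ler_wpM2r.
have h2 : Q <= 6 * (K * (1 + g) ^+ 2) * k ^+ 2.
  rewrite /Q; have a1 : K * (1 + g) * k <= K * (1 + g) * k ^+ 2 by rewrite ler_wpM2l.
  have a2 : 0 <= K * g * k ^+ 2 by rewrite mulr_ge0.
  have a3 : 0 <= K * g * g * k ^+ 2 by rewrite !mulr_ge0.
  lra.
have a1 : K * k <= K * k ^+ 2 by rewrite ler_wpM2l.
have a2 : 0 <= K * g * k ^+ 2 by rewrite mulr_ge0.
have a3 : 0 <= K * g * g * k ^+ 2 by rewrite !mulr_ge0.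
have a4 : 0 <= K * k ^+ 2 by rewrite mulr_ge0.
by move: h1 h2; clearbody Q; lra.
Qed.

End ErrorBudget.

(** * Lipschitz functions of lists and grafting *)

Section LipschitzLists.
Variables (R : realType).
Implicit Types (w x y : seq R) (F : seq R -> R).

Lemma wdist_cat w1 w2 x1 x2 y1 y2 : size x1 = size w1 -> size y1 = size w1 ->
  wdist (w1 ++ w2) (x1 ++ x2) (y1 ++ y2) = wdist w1 x1 y1 + wdist w2 x2 y2.
Proof.
elim: w1 x1 y1 => [|a w1 IH] [|b x1] [|c y1] //=; first by rewrite add0r.
by move=> [sx] [sy]; rewrite IH// addrA.
Qed.

Lemma cube_cat m n x y : size x = m -> cube (m + n) (x ++ y) = all (@in01 R) x && cube n y.
Proof. by move=> <-; rewrite /cube size_cat eqn_add2l all_cat andbCA. Qed.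

Lemma lips_catr w1 w2 F x : lips (w1 ++ w2) F -> cube (size w1) x ->
  lips w2 (fun y => F (x ++ y)).
Proof.
move=> h /andP[/eqP sx x01] y z cy cz; have := h (x ++ y) (x ++ z).
by rewrite size_cat !cube_cat// x01 cy cz wdist_cat// wdistxx add0r; apply.
Qed.

Lemma lips_subE N c w (T : Type) (l : seq T) (f : seq T -> seq R -> R) :
  0 <= c / N%:R <= 1 -> (forall S, lips w (f S)) -> lips w (fun x => subE N c l (fun S => f S x)).
Proof.
case/andP=> p0 p1; elim: l f => [|v l IH] f h; first exact: h.
move=> x y cx cy /=.
set p := c / _ in p0 p1 *.
have := IH (fun S => f (v :: S)) (fun S => h (v :: S)) _ _ cx cy.
have := IH f h _ _ cx cy.
rewrite !ler_norml; move: (subE _ _ _ _) (subE _ _ _ _) (subE _ _ _ _) (subE _ _ _ _) => a b d e.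
by move=> /andP[h1 h2] /andP[h3 h4]; apply/andP; split; nra.
Qed.

Section Rint.
Variable nu : probability R R.
Hypothesis nu01 : nu `[0%R, 1%R]%classic = 1%E.

Lemma rint_subE N c w (T : Type) (l : seq T) (f : seq T -> seq R -> R) :
  0 <= c / N%:R <= 1 -> (forall S, lips w (f S)) ->
  rint nu (size w) (fun x => subE N c l (fun S => f S x)) =
  subE N c l (fun S => rint nu (size w) (f S)).
Proof.
move=> p01; elim: l f => [|v l IH] f h //=.
have h1 := lips_subE l p01 (fun S => h (v :: S)).
have h2 := lips_subE l p01 h.
rewrite -(IH _ (fun S => h (v :: S))) -(IH _ h) -(rintZ nu01 _ h1) -(rintZ nu01 _ h2).
have hZ k F : lips w F -> lips (map ( *%R `|k|) w) (fun x => k * F x).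
  move=> hF x y; rewrite size_map => cx cy.
  by rewrite -mulrBr normrM wdistZ ler_wpM2l// hF.
have := rintD nu01 _ (hZ (c / N%:R) _ h1) (hZ (1 - c / N%:R) _ h2).
by rewrite !size_map; apply.
Qed.

Lemma lips_rint w1 w2 F : lips (w1 ++ w2) F ->
  lips w1 (fun x => rint nu (size w2) (fun y => F (x ++ y))).
Proof.
move=> h.
have H x x' : cube (size w1) x -> cube (size w1) x' ->
    rint nu (size w2) (fun y => F (x ++ y)) <=
    rint nu (size w2) (fun y => F (x' ++ y)) + wdist w1 x x'.
  move=> cx cx'; apply: (rint_le nu01 (w := w2) (w' := w2)) => //; try exact: lips_catr h _.
  move=> y cy; rewrite -lerBlDl; apply: le_trans (ler_norm _) _.
  have /andP[/eqP sx x01] := cx; have /andP[/eqP sx' x01'] := cx'.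
  have := h (x ++ y) (x' ++ y).
  by rewrite size_cat !cube_cat// x01 x01' cy wdist_cat// wdistxx addr0; apply.
have wC x y : wdist w1 x y = wdist w1 y x.
  by elim: w1 x y {h H} => [|a w1 IH] [|b x] [|d y] //=; rewrite distrC IH.
move=> x y cx cy; rewrite ler_norml; have := H _ _ cx cy; have := H _ _ cy cx.
rewrite (wC y); move: (rint _ _ _) (rint _ _ _) => a b; lra.
Qed.

Lemma rint_cat_in w1 w2 F (f : seq R -> seq R -> R) : lips (w1 ++ w2) F ->
  (forall x y, cube (size w1) x -> cube (size w2) y -> F (x ++ y) = f x y) ->
  rint nu (size w1 + size w2) F = rint nu (size w1) (fun x => rint nu (size w2) (f x)).
Proof.
move=> h e; rewrite rint_cat; apply: (eq_rint nu01 (lips_rint h)) => x cx.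
by apply: (eq_rint nu01 (lips_catr h cx)) => y cy; exact: e.
Qed.

End Rint.

Variables (t a0 : R).
Hypotheses (t_gt0 : 0 < t) (t_le1 : t <= 1) (a00 : 0 <= a0).

(* Entry [r] of the argument of [F] is replaced by [phi] of the block of length [s] found there. *)
Definition graft r s F z : R :=
  F (take r z ++ phi t a0 (take s (drop r z)) :: drop s (drop r z)).

Lemma graft_cat r s F x y z : size x = r -> size y = s ->
  graft r s F (x ++ y ++ z) = F (x ++ phi t a0 y :: z).
Proof. by move=> sx sy; rewrite /graft take_size_cat// drop_size_cat// take_size_cat// drop_size_cat. Qed.

Lemma cube_split m n x : cube (m + n) x -> exists y z, [/\ x = y ++ z, cube m y & cube n z].
Proof.
case/andP=> /eqP sx x01; exists (take m x), (drop m x); split; first by rewrite cat_take_drop.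
  rewrite /cube size_takel ?sx ?leq_addr// eqxx/=; apply/allP => u /mem_take; exact/allP.
by rewrite /cube size_drop sx addKn eqxx/=; apply/allP => u /mem_drop; exact/allP.
Qed.

Lemma lips_graft w1 a w2 s F : 0 <= a -> lips (w1 ++ a :: w2) F ->
  lips (w1 ++ nseq s (a * lipc t) ++ w2) (graft (size w1) s F).
Proof.
move=> a_ge0 h x y; rewrite !size_cat size_nseq.
case/cube_split=> x1 [x'] [-> cx1 /cube_split[x2 [x3 [-> cx2 cx3]]]].
case/cube_split=> y1 [y'] [-> cy1 /cube_split[y2 [y3 [-> cy2 cy3]]]].
have /andP[/eqP sx1 x101] := cx1; have /andP[/eqP sx2 x201] := cx2.
have /andP[/eqP sy1 y101] := cy1; have /andP[/eqP sy2 y201] := cy2.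
rewrite !graft_cat// !wdist_cat ?size_nseq//.
have := h (x1 ++ phi t a0 x2 :: x3) (y1 ++ phi t a0 y2 :: y3).
rewrite size_cat/= !cube_cat// !cube_cons x101 y101 cx3 cy3 !phi01//= => /(_ isT isT).
move/le_trans; apply; rewrite wdist_cat//= lerD2l lerD2r.
have -> : nseq s (a * lipc t) = map ( *%R a) (nseq s (lipc t)) by rewrite map_nseq.
by rewrite wdistZ ler_wpM2l// -sx2; apply: phi_lip; rewrite ?sx2 ?sy2.
Qed.

End LipschitzLists.

(** * Comparison of the graph with the fixpoint, vertex by vertex *)

Section Recursion.
Variables (R : realType) (nu : probability R R) (b h c t : R) (N : nat).
Let p : R := c / N%:R.
Let L : R := lipc t.
Let K : R := 4 * (1 + c) ^+ 2 * (1 + L).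
Hypotheses (t_gt0 : 0 < t) (t_le1 : t <= 1) (tb : t ^+ 2 = expR (- b)).
Hypotheses (c_ge0 : 0 <= c) (N_gt0 : (0 < N)%N) (c_le : c <= N%:R).
Hypotheses (Lc : L * c <= 1 / 14) (Lc2 : L * c ^+ 2 <= 1 / 28).
Hypothesis fp : is_T_fixpoint b h c nu.

Local Notation E F := (@Egraph R N c F).
(** Deleted vertices remain in ['I_N] with weight 0, so [marg A] is the occupation in the graph
    induced on [A]. *)
Definition act (A : seq 'I_N) : 'I_N -> R := fun w => if w \in A then expR h else 0.
Definition marg A G : 'I_N -> R := fun w => occ t (adj G) (act A) w.

Let N0 : 0 < N%:R :> R. Proof. by rewrite ltr0n. Qed.
Let p_ge0 : 0 <= p. Proof. by rewrite divr_ge0 // ltW. Qed.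
Let p_le1 : p <= 1. Proof. by rewrite ler_pdivrMr// mul1r. Qed.
Let p01 : 0 <= c / N%:R <= 1. Proof. by rewrite p_ge0. Qed.
Let L0 : 0 <= L. Proof. exact: lipc_ge0. Qed.
Let K0 : 0 <= K. Proof. by rewrite !mulr_ge0 ?sqr_ge0// addr_ge0. Qed.
Let pN : p * N%:R = c. Proof. by rewrite /p divfK// gt_eqF. Qed.
Let LpN : L * (p * N%:R) <= 1 / 2. Proof. by by rewrite pN (le_trans Lc)//; lra. Qed.
Let Lp0 : 0 <= 2 * L * p. Proof. by apply: mulr_ge0 => //; apply: mulr_ge0. Qed.
Let nu01 : nu `[0%R, 1%R]%classic = 1%E. Proof. exact: fp.1. Qed.

Lemma act_ge0 (A : seq 'I_N) w : 0 <= act A w.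
Proof. by rewrite /act; case: ifP => // _; exact: expR_ge0. Qed.

Lemma act_notin (A : seq 'I_N) w : w \notin A -> act A w = 0.
Proof. by rewrite /act => /negbTE ->. Qed.

Lemma zap_act (A : seq 'I_N) v : zap v (act A) = act [seq w <- A | w != v].
Proof. by apply/funext => w; rewrite /zap /act mem_filter; case: eqP. Qed.

(** The requirement behind the choice of [K]. In units of [a / N], the first four terms are the
    errors of [replace_head], and the last one bounds that of [rint_replace]. *)
Lemma step_error (k r d : R) : 0 <= k -> 0 <= r -> 0 <= d ->
  2 * L ^+ 2 * c * r + 2 * L ^+ 2 * c ^+ 3 + L * c * (r + k) + 2 * (L * c) * k +
    2 * (c + 2 * c ^+ 2 + c * (d + r + (k + 1))) <= K * (1 + d + (k + 1) + r).
Proof.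
have c0 := c_ge0; move=> k0 r0 d0.
have a1 : L * (L * c) * r <= L * (1 / 14) * r by rewrite ler_wpM2r// ler_wpM2l.
have a2 : L * c * (L * c ^+ 2) <= 1 / 14 * (1 / 28).
  by rewrite ler_pM// mulr_ge0// sqr_ge0.
have a3 : L * c * (r + k) <= 1 / 14 * (r + k) by rewrite ler_wpM2r// addr_ge0.
have a4 : L * c * k <= 1 / 14 * k by rewrite ler_wpM2r.
have b1 : 0 <= c * d by rewrite mulr_ge0.
have b2 : 0 <= c * r by rewrite mulr_ge0.
have b3 : 0 <= c * k by rewrite mulr_ge0.
have b4 : 0 <= L * r by rewrite mulr_ge0.
have c20 : 0 <= c ^+ 2 by rewrite sqr_ge0.
have u0 : 0 <= 1 + d + (k + 1) + r by rewrite !addr_ge0.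
have e1 : (4 * (1 + c) ^+ 2 + 4 * L) * (1 + d + (k + 1) + r) <= K * (1 + d + (k + 1) + r).
  rewrite ler_wpM2r// /K -subr_ge0.
  have -> : 4 * (1 + c) ^+ 2 * (1 + L) - (4 * (1 + c) ^+ 2 + 4 * L) = 4 * (L * (2 * c + c ^+ 2)) by ring.
  by rewrite mulr_ge0// mulr_ge0// addr_ge0// mulr_ge0.
apply: le_trans e1.
have b5 : 0 <= c ^+ 2 * (1 + d + k + r) by rewrite mulr_ge0// !addr_ge0.
have b6 : 0 <= L * (2 + d + k) by rewrite mulr_ge0// !addr_ge0.
rewrite -subr_ge0.
apply: (@le_trans _ _ (2 * (L * (1 / 14) * r - L * (L * c) * r) +
  2 * (1 / 14 * (1 / 28) - L * c * (L * c ^+ 2)) +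
  (1 / 14 * (r + k) - L * c * (r + k)) + 2 * (1 / 14 * k - L * c * k) + 4 * (c ^+ 2 * (1 + d + k + r)) +
  4 * (L * (2 + d + k)) + 6 * (c * d + c * r + c * k) + c + k + r + 1 + 2 * (L * r))).
  lra.
lra.
Qed.

Lemma marg01 A G w : in01 (marg A G w).
Proof. by rewrite /in01 occ_ge0 ?occ_le1//; (exact: adjC || exact: adjI || exact: act_ge0). Qed.

Lemma cube_marg A G (us : seq 'I_N) : cube (size us) (map (marg A G) us).
Proof. by rewrite /cube size_map eqxx; apply/allP => _ /mapP[w _ ->]; exact: marg01. Qed.

Lemma Esum_marg (A : seq 'I_N) v us : uniq A -> v \in A -> {subset us <= A} -> v \notin us ->
  E (fun G => \sum_(u <- us) `|marg [seq w <- A | w != v] G u - marg A G u|)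
    <= (size us)%:R * (2 * L * p).
Proof.
move=> uA vA sus vus; rewrite Egraph_sum; apply: sumr_le_const => // u uus.
rewrite [X in X <= _](_ : _ = E (fun G => `|occ t (adj G) (act A) u - occ t (adj G) (zap v (act A)) u|)).
  apply: (@Eocc_zap _ _ c t t_gt0 t_le1 p_ge0 p_le1 LpN A (act A) v u) => //.
  - exact: sus.
  - by apply: contraNneq vus => <-.
  - exact: act_ge0.
  - by move=> w; exact: act_notin.
by apply: eq_bigr => G _; rewrite distrC /marg zap_act.
Qed.

(** Four errors: deleting [v] moves the means of [us] and [vs] ([d1], [d4]), [v] is replaced by
    [phi] of its neighbours ([d2]), and neighbours already listed are dropped ([d3]), so that no
    vertex occurs twice in the new list. *)
Lemma replace_head (A : seq 'I_N) us v vs a F :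
  uniq A -> v \in A -> uniq (us ++ v :: vs) -> {subset us ++ v :: vs <= A} -> 0 <= a ->
  lips (nseq (size us) (a * L) ++ a :: nseq (size vs) a) F ->
  forall A' l, A' = [seq w <- A | w != v] -> l = [seq w <- A' | w \notin us ++ vs] ->
  E (fun G => F (map (marg A' G) us ++
      phi t (expR h) (map (marg A' G) (nb (adj G) l v)) :: map (marg A' G) vs)) <=
  E (fun G => F (map (marg A G) us ++ map (marg A G) (v :: vs))) +
    a * ((2 * L ^+ 2 * c * (size us)%:R + 2 * L ^+ 2 * c ^+ 3 +
      L * c * ((size us)%:R + (size vs)%:R) + 2 * (L * c) * (size vs)%:R) / N%:R).
Proof.
move=> uA vA uuv sA a0 hF A' l A'E lE.
have uA' : uniq A' by rewrite A'E filter_uniq.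
have vA' : v \notin A' by rewrite A'E mem_filter eqxx.
have [vus vvs] : v \notin us /\ v \notin vs.
  move: uuv; rewrite cat_uniq /= negb_or => /and3P[_ /andP[v1 _] /andP[v2 _]].
  by split.
have sus : {subset us <= A} by move=> w wu; apply: sA; rewrite mem_cat wu.
have svs : {subset vs <= A} by move=> w wu; apply: sA; rewrite mem_cat inE wu !orbT.
have actv : act A v = expR h by rewrite /act vA.
pose d1 G := \sum_(u <- us) `|marg A' G u - marg A G u|.
pose d2 G := `|marg A G v - phi t (expR h) (map (marg A' G) (nb (adj G) A' v))|.
pose d3 G := `|phi t (expR h) (map (marg A' G) (nb (adj G) A' v)) -
   phi t (expR h) (map (marg A' G) (nb (adj G) l v))|.
pose d4 G := \sum_(u <- vs) `|marg A' G u - marg A G u|.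
apply: (@le_trans _ _ (E (fun G => F (map (marg A G) us ++ map (marg A G) (v :: vs)) +
   ((a * L) * d1 G + (a * d2 G + (a * d3 G + a * d4 G)))))).
  apply: le_Egraph => // G; rewrite -lerBlDl; apply: le_trans (ler_norm _) _.
  have e0 := expR_ge0 h.
  apply: le_trans (hF _ _ _ _) _.
  - rewrite size_cat/= !size_nseq cube_cat ?size_map// cube_cons.
    have /andP[_ ->] := cube_marg A' G us; rewrite (cube_marg A' G vs) phi01 //.
    by apply/allP => _ /mapP[w _ ->]; exact: marg01.
  - rewrite size_cat/= !size_nseq cube_cat ?size_map// cube_cons.
    have /andP[_ ->] := cube_marg A G us; rewrite (cube_marg A G vs) ?andbT /=.
    exact: marg01.
  rewrite wdist_cat ?size_map ?size_nseq//= lerD//.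
    by apply: wdist_map => //; rewrite mulr_ge0.
  rewrite addrA lerD//; last by apply: wdist_map.
  rewrite -mulrDr ler_wpM2l// distrC; exact: ler_distD.
rewrite EgraphD lerD2l !EgraphD !EgraphZ.
have h1 : E d1 <= (size us)%:R * (2 * L * p) by rewrite /d1 A'E; exact: Esum_marg.
have h4 : E d4 <= (size vs)%:R * (2 * L * p) by rewrite /d4 A'E; exact: Esum_marg.
have margE G : marg A' G = fun w => occ t (adj G) (zap v (act A)) w.
  by rewrite /marg zap_act A'E.
have h2 : E d2 <= 2 * L ^+ 2 * p * (p * N%:R) ^+ 2.
  have := @Eocc_phi _ _ c t t_gt0 t_le1 p_ge0 p_le1 LpN A (act A) v uA vA (act_ge0 A) (@act_notin A).
  rewrite -A'E actv => H; apply: le_trans H; apply: le_Egraph => // G.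
  by rewrite /d2 margE.
have szl : (size [seq w <- A' | ~~ (w \notin us ++ vs)] <= size us + size vs)%N.
  rewrite -size_cat; apply: uniq_leq_size; first exact: filter_uniq.
  by move=> w; rewrite mem_filter negbK => /andP[].
have h3 : E d3 <= L * ((size us + size vs)%:R * p).
  have lv : 0 <= act A v by exact: act_ge0.
  have := @Ephi_drop _ _ c t t_gt0 t_le1 p_ge0 p_le1 A' (act A) _ v _ uA' vA' lv (act_ge0 A) szl.
  rewrite actv -lE => H; apply: le_trans H; apply: le_Egraph => // G.
  by rewrite /d3 margE.
have N1 : N%:R^-1 * N%:R = 1 :> R by rewrite mulVf// gt_eqF.
rewrite pN in h2; rewrite natrD in h3.
have g1 := ler_wpM2l (mulr_ge0 a0 L0) h1.
have g2 := ler_wpM2l a0 h2.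
have g3 := ler_wpM2l a0 h3.
have g4 := ler_wpM2l a0 h4.
apply: (le_trans (lerD g1 (lerD g2 (lerD g3 g4)))).
by rewrite le_eqVlt; apply/orP; left; apply/eqP; rewrite /p; ring.
Qed.

(** This is [fixpoint_le] in the middle coordinate, those of [w1] being frozen and those of [w2]
    integrated out. *)
Lemma rint_replace w1 a w2 F (T : Type) (l : seq T) : lips (w1 ++ a :: w2) F -> 0 <= a ->
  (size l <= N)%N ->
  rint nu (size w1 + (size w2).+1) F <=
    subE N c l (fun S => rint nu (size w1 + (size S + size w2)) (graft t (expR h) (size w1) (size S) F))
    + 2 * a * fixpoint_err c N (size l).
Proof.
move=> hF a0 lN; have e0 := expR_ge0 h.
pose f (S : seq T) xs := rint nu (size S + size w2)
  (fun ws => graft t (expR h) (size w1) (size S) F (xs ++ ws)).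
have hg (S : seq T) := lips_graft t_gt0 t_le1 e0 (s := size S) a0 hF.
have hf S : lips w1 (f S).
  by have := lips_rint nu01 (hg S); rewrite size_cat size_nseq.
rewrite (eq_subE _ _ _ (f' := fun S => rint nu (size w1) (f S))) => [|S]; last exact: rint_cat.
rewrite -(rint_subE nu01 l p01 hf) rint_cat.
have hl := lips_rint nu01 hF.
apply: (rint_le nu01 (w := w1) (w' := w1)) => // [|xs cx].
  exact: lips_subE.
have hx := lips_catr hF cx.
have := fixpoint_le t_gt0 t_le1 tb c_ge0 N_gt0 c_le fp (rint_lip1 nu01 hx) lN.
move/le_trans; apply; rewrite lerD2r le_eqVlt; apply/orP; left; apply/eqP.
apply: eq_subE => S; have := lips_catr (hg S) cx => hgx.
have := @rint_cat_in _ _ nu01 (nseq (size S) (a * lipc t)) w2 _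
  (fun ys zs => F (xs ++ phi t (expR h) ys :: zs)) hgx.
rewrite size_nseq /f => -> // ys zs /andP[/eqP sy _] _.
by rewrite graft_cat//; have /andP[/eqP ->] := cx.
Qed.

(** [us] holds the new vertices, [vs] those still to be replaced, and [N - n] vertices are deleted.
    Quantifying over all [F] lets the induction pass to grafted test functions. *)
Definition lower_bound (n : nat) := forall (A us vs : seq 'I_N) (a : R) (F : seq R -> R),
  uniq A -> size A = n -> uniq (us ++ vs) -> {subset us ++ vs <= A} -> 0 <= a ->
  lips (nseq (size us) (a * L) ++ nseq (size vs) a) F ->
  rint nu (size us + size vs) F <= E (fun G => F (map (marg A G) us ++ map (marg A G) vs)) +
    a * (budget L c K (size vs)%:R (size us)%:R (N - n)%:R / N%:R).

(** On both sides [v] becomes the same random list [S]: by [rint_replace] in the limit, by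
    [replace_head] and [Egraph_expose] on the graph. For fixed [S] the induction hypothesis compares
    them, and the budget is then averaged over [S]. *)
Lemma lower_bound_step n (A us : seq 'I_N) v vs (a : R) (F : seq R -> R) : lower_bound n ->
  uniq A -> size A = n.+1 -> uniq (us ++ v :: vs) -> {subset us ++ v :: vs <= A} -> 0 <= a ->
  lips (nseq (size us) (a * L) ++ nseq (size vs).+1 a) F ->
  rint nu (size us + (size vs).+1) F <=
    E (fun G => F (map (marg A G) us ++ map (marg A G) (v :: vs))) +
    a * (budget L c K (size vs).+1%:R (size us)%:R (N - n.+1)%:R / N%:R).
Proof.
move=> IH uA sA uuv subA a0 hF; have e0 := expR_ge0 h.
set k := size vs; set r := size us; set d := (N - n.+1)%N.
have nN : (n < N)%N by rewrite -sA; exact: size_uniq_ord.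
have vA : v \in A by apply: subA; rewrite mem_cat mem_head orbT.
have [vus vvs] : v \notin us /\ v \notin vs.
  move: uuv; rewrite cat_uniq /= negb_or => /and3P[_ /andP[v1 _] /andP[v2 _]].
  by split.
have uus : uniq (us ++ vs).
  move: uuv; rewrite !cat_uniq /= negb_or => /and3P[-> /andP[_ ->] /andP[_ ->]].
  by [].
pose A' := [seq w <- A | w != v]; pose l := [seq w <- A' | w \notin us ++ vs].
have uA' : uniq A' by rewrite filter_uniq.
have ul : uniq l by rewrite filter_uniq.
have vl : v \notin l by rewrite !mem_filter eqxx andbF.
have sA' : size A' = n.
  rewrite /A' size_filter -[n]/(n.+1.-1) -sA -(count_predC (pred1 v) A).
  by rewrite count_uniq_mem// vA.
have lN : (size l <= N)%N by exact: size_uniq_ord.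
(* Outside [l] there are the [d + 1] vertices missing from [A'] and at most [r + k] vertices of
   [us ++ vs]. *)
have dl : (N - size l <= d + r + k.+1)%N.
  have : (n <= size l + (r + k))%N.
    rewrite -sA' -(count_predC (fun w => w \notin us ++ vs) A') /l size_filter leq_add2l.
    rewrite -size_filter -size_cat; apply: uniq_leq_size; first exact: filter_uniq.
    by move=> w; rewrite mem_filter /= negbK => /andP[].
  rewrite /d; move: (size l) r k nN; clear; lia.
have dN : (N - n)%:R = d%:R + 1 :> R by rewrite natr1 /d subnSK.
have := rint_replace (w1 := nseq r (a * L)) (a := a) (w2 := nseq k a) (l := l) hF a0 lN.
rewrite !size_nseq => /le_trans; apply.
pose f (S : seq 'I_N) G := F (map (marg A' G) us ++
      phi t (expR h) (map (marg A' G) S) :: map (marg A' G) vs).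
have hF' : lips (nseq r (a * L) ++ a :: nseq k a) F by exact: hF.
(* All means refer to [A'], where [v] has weight 0, so they do not read the edges at [v]. *)
have of_ S : off v (f S).
  move=> G G' e; have em : marg A' G = marg A' G'.
    by apply/funext => w; rewrite /marg -zap_act; exact: (off_occ t (act A) w e).
  by rewrite /f em.
have X1 := replace_head uA vA uuv subA a0 hF erefl erefl.
rewrite -/A' -/l -/r -/k (Egraph_expose _ ul vl of_) in X1.
have S1 : subE N c l (fun S => rint nu (r + (size S + k)) (graft t (expR h) r (size S) F)) <=
    subE N c l (fun S => E (f S) + a / N%:R * budget L c K k%:R (r%:R + (size S)%:R) (d%:R + 1)).
  apply: le_subE => // S sS.
  have /subseq_uniq/(_ ul) uS := sS.
  have inS w : w \in S -> w \in l by exact: (mem_subseq sS).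
  have inA w : w \in l -> w \in A' /\ w \notin us ++ vs by rewrite mem_filter => /andP[].
  have inA' w : w \in us ++ vs -> w \in A'.
    move=> wu; rewrite mem_filter subA ?andbT; last first.
      by move: wu; rewrite !mem_cat inE => /orP[->//|->]; rewrite !orbT.
    by apply: contraTneq wu => ->; rewrite mem_cat negb_or vus.
  have H := IH A' (us ++ S) vs a (graft t (expR h) r (size S) F) uA' sA' _ _ a0.
  rewrite size_cat nseqD -catA -addnA in H; apply: le_trans (H _ _ _) _.
  - rewrite uniq_catCA in H *; rewrite cat_uniq uS uus andbT /=.
    by apply/hasPn => w wu; apply/negP => /inS /inA[_]; rewrite wu.
  - move=> w; rewrite mem_cat => /orP[|]; rewrite ?mem_cat => wu.
      by apply: inA'; rewrite mem_cat wu.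
    case/orP: wu => [/inS/inA[]//|wu].
    by apply: inA'; rewrite mem_cat wu orbT.
  - by have := lips_graft t_gt0 t_le1 e0 (s := size S) a0 hF'; rewrite size_nseq -catA.
  rewrite le_eqVlt; apply/orP; left; apply/eqP; congr (_ + _).
    by apply: eq_bigr => G _; rewrite map_cat -catA graft_cat ?size_map.
  by rewrite natrD dN; ring.
apply: le_trans (lerD S1 (lexx _)) _.
rewrite subED subEZ (eq_subE _ _ _ (fun S => budget_poly L c K k%:R r%:R d%:R (size S)%:R)).
rewrite subED subE_cst subED !subEZ.
set m := subE N c l (fun S => (size S)%:R); set q := subE N c l (fun S => (size S)%:R ^+ 2).
have mE : m = p * (size l)%:R by exact: subE_size.
have m0 : 0 <= m <= c.
  by rewrite mE mulr_ge0//= -pN ler_wpM2l// ler_nat.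
have qm : q <= m + m ^+ 2 by rewrite mE; exact: subE_size2.
have B := budget_step L0 c_ge0 K0 (ler0n R k) (ler0n R r) (ler0n R d) m0 qm.
have T := step_error (ler0n R k) (ler0n R r) (ler0n R d).
rewrite natr1 in B T.
have Er : fixpoint_err c N (size l) <= (c + 2 * c ^+ 2 + c * (d%:R + r%:R + k.+1%:R)) / N%:R.
  rewrite /fixpoint_err ler_wpM2r ?invr_ge0 ?(ltW N0)// lerD2l ler_wpM2l//.
  by rewrite -!natrD ler_nat.
have aN : 0 <= a / N%:R by rewrite divr_ge0// ltW.
have Er2 := ler_wpM2l (mulr_ge0 (ler0n R 2) a0) Er.
have BT := ler_wpM2l aN (lerD T B).
move: X1 Er2 BT; set Y := E _; set Z := subE _ _ _ _.
move: (fixpoint_err _ _ _) (budget _ _ _ _ _ _) (budget_c0 _ _ _ _ _ _)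
  (budget_c1 _ _ _ _ _ _ * _ + _) => u w x y.
rewrite -/r -/k => X1 Er2 BT.
rewrite -subr_ge0 in X1; rewrite -subr_ge0 in Er2; rewrite -subr_ge0 in BT.
rewrite -subr_ge0; apply: le_trans (addr_ge0 (addr_ge0 X1 Er2) BT) _.
by rewrite le_eqVlt; apply/orP; left; apply/eqP; ring.
Qed.

Lemma lower_bound_all n : lower_bound n.
Proof.
have nil0 (A : seq 'I_N) (a d : R) (F : seq R -> R) : 0 <= a ->
    rint nu 0 F <= E (fun G => F (map (marg A G) [::] ++ map (marg A G) [::])) +
      a * (budget L c K 0 0 d / N%:R).
  move=> _; rewrite /= Egraph_cst (_ : budget _ _ _ _ _ _ = 0); last by rewrite /budget; ring.
  by rewrite mul0r mulr0 addr0.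
elim: n => [|n IH] A us vs a F uA sA uuv subA a0 hF.
  have A0 : A = [::] by apply/size0nil.
  have [us0 vs0] : us = [::] /\ vs = [::].
    split; first by case: us subA {uuv hF} => // u us /(_ u); rewrite A0 mem_head => /(_ isT).
    by case: vs subA {uuv hF} => // u vs /(_ u); rewrite A0 mem_cat mem_head orbT => /(_ isT).
  by rewrite us0 vs0; exact: nil0.
case: vs uuv subA hF => [|v vs] uuv subA hF; last exact: lower_bound_step.
case: us uuv subA hF => [|u us] uuv subA hF; first exact: nil0.
rewrite /= !cats0 in uuv subA hF; rewrite addn0.
have -> : E (fun G => F (map (marg A G) (u :: us) ++ map (marg A G) [::])) =
    E (fun G => F (map (marg A G) (u :: us))).
  by apply: eq_bigr => G _; rewrite cats0.
(* Only new entries are left: they become old ones for the constant [a * L]. A replacement follows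
   at once, because relabelling alone does not shrink [A]. *)
have := @lower_bound_step n A [::] u us (a * L) F IH uA sA uuv subA (mulr_ge0 a0 L0) hF.
move/le_trans; apply; rewrite lerD2l -mulrA ler_wpM2l// mulrA ler_wpM2r ?invr_ge0 ?(ltW N0)//.
by apply: budget_relabel => //; rewrite ?Lc ?Lc2.
Qed.

End Recursion.

(** * The Gibbs measure in hard-core form *)

Section GibbsHardCore.
Variables (R : realType) (N : nat) (b h t : R).
Hypotheses (t_gt0 : 0 < t) (tb : t ^+ 2 = expR (- b)).
Implicit Types (G : {ffun edge N -> bool}) (s : N.-tuple bool).

Local Notation lamh := (fun _ : 'I_N => expR h).

Lemma prod_edge (f : 'I_N -> 'I_N -> R) : (forall i j, f i j = f j i) -> (forall i, f i i = 1) ->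
  \prod_i \prod_j f i j = \prod_(e : edge N) f (val e).1 (val e).2 ^+ 2.
Proof.
move=> fC fI.
have sub : \prod_(q : 'I_N * 'I_N | (q.1 < q.2)%N) f q.1 q.2 = \prod_(e : edge N) f (val e).1 (val e).2.
  rewrite (@reindex_omap _ _ _ _ _ (val : edge N -> _) insub)/= => [|q qlt]; last by rewrite insubT.
  by apply: eq_bigl => e; rewrite valK eqxx andbT (valP e).
have sub2 : \prod_(q : 'I_N * 'I_N | (q.2 < q.1)%N) f q.1 q.2 = \prod_(e : edge N) f (val e).1 (val e).2.
  rewrite -sub (reindex_inj (h := fun q : 'I_N * 'I_N => (q.2, q.1)))/=.
    by apply: eq_bigr => -[i j] _ /=; exact: fC.
  by move=> [? ?] [? ?] /= [-> ->].
rewrite (eq_bigr (fun e : edge N => f (val e).1 (val e).2 * f (val e).1 (val e).2)) => [|e _];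
  last exact: expr2.
rewrite big_split/= -{1}sub -sub2 pair_bigA/=.
rewrite (bigID (fun q : 'I_N * 'I_N => (q.1 < q.2)%N))/=; congr (_ * _).
rewrite (bigID (fun q : 'I_N * 'I_N => (q.2 < q.1)%N))/= [X in _ * X]big1 ?mulr1 => [|[i j]] /=.
  by apply: eq_bigl => -[i j] /=; case: ltngtP.
by case: (ltngtP i j) => //= /val_inj -> _; exact: fI.
Qed.

Lemma expR_Ham G s : expR (Ham b h G s) = wt t (adj G) lamh (finfun (tnth s)).
Proof.
rewrite /Ham expRD /wt; congr (_ * _).
  rewrite mulr_sumr expR_sum; apply: eq_bigr => i _; rewrite ffunE.
  by case: (tnth s i); rewrite ?mulr1// mulr0 expR0.
rewrite prod_edge => [|i j|i]; last 2 first.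
- by rewrite adjC; case: (finfun _ i); case: (finfun _ j).
- by rewrite adjI !andbF.
rewrite -mulNr mulr_sumr expR_sum; apply: eq_bigr => e _.
rewrite !ffunE adj_lt; case: (G e); case: (tnth s _); case: (tnth s _);
  by rewrite ?(mul0r, mulr0, mulr1, expR0, expr1n, tb).
Qed.

Lemma gibbs_avg G (F : N.-tuple bool -> R) (F' : {ffun 'I_N -> bool} -> R) :
  (forall s, F s = F' (finfun (tnth s))) -> gibbs b h G F = avg t (adj G) lamh F'.
Proof.
move=> e.
have H (f : N.-tuple bool -> R) f' : (forall s, f s = f' (finfun (tnth s))) ->
    \sum_(s : N.-tuple bool) expR (Ham b h G s) * f s = wsum t (adj G) lamh f'.
  move=> ef; rewrite /wsum (reindex (fun s : N.-tuple bool => finfun (tnth s)))/=.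
    by apply: eq_bigr => s _; rewrite expR_Ham ef.
  exists (fun s : {ffun 'I_N -> bool} => [tuple s i | i < N]) => [s _|s _].
    by apply: eq_from_tnth => i; rewrite tnth_mktuple ffunE.
  by apply/ffunP => i; rewrite ffunE tnth_mktuple.
rewrite /gibbs /avg -(H _ _ e) -(H (fun=> 1) (fun=> 1))//; congr (_ / _).
by apply: eq_bigr => s _; rewrite mulr1.
Qed.

Lemma gibbs_bounds G (F : N.-tuple bool -> R) lo hi : (forall s, lo <= F s <= hi) ->
  lo <= gibbs b h G F <= hi.
Proof.
move=> FB; rewrite /gibbs; set Z := \sum_(s : N.-tuple bool) expR _.
have Z0 : 0 < Z.
  rewrite /Z (bigD1 [tuple of nseq N false])//= ltr_pwDl ?expR_gt0//.
  by apply: sumr_ge0 => s _; exact: expR_ge0.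
rewrite ler_pdivlMr// ler_pdivrMr// /Z !mulr_sumr.
apply/andP; split; apply: ler_sum => s _; have /andP[? ?] := FB s.
  by rewrite mulrC ler_wpM2l ?expR_ge0.
by rewrite [X in _ <= X]mulrC ler_wpM2l ?expR_ge0.
Qed.

End GibbsHardCore.

(** * Assembly of the estimate for given [f] and [g] *)

Section LocalLimit.
Variables (R : realType) (nu : probability R R) (b h c : R) (N k : nat) (Hk : (k <= N)%N).
Hypotheses (b_ge0 : 0 <= b) (c_ge0 : 0 <= c) (C_lt1 : Cbg b c < 1).
Hypotheses (c_le : c <= N%:R) (k_gt0 : (0 < k)%N).
Hypothesis fp : is_T_fixpoint b h c nu.
Variables (f : k.-tuple bool -> R) (g : R -> R) (Lg : R).
Hypotheses (Lg_ge0 : 0 <= Lg) (g_lip : lipschitz_itv g Lg (fmin f) (fmax f)).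

Let t : R := expR (- (b / 2)).
Let L : R := lipc t.
Let p : R := c / N%:R.
Let K : R := 4 * (1 + c) ^+ 2 * (1 + L).
Local Notation E F := (@Egraph R N c F).
Local Notation M := (supnorm f).
Local Notation V := (enum 'I_N).
Local Notation marg G := (@marg R h t N V G).

Let N_gt0 : (0 < N)%N. Proof. exact: leq_trans Hk. Qed.
Let N0 : 0 < N%:R :> R. Proof. by rewrite ltr0n. Qed.
Let t_gt0 : 0 < t. Proof. exact: expR_gt0. Qed.
Let t_le1 : t <= 1. Proof. by rewrite -expR0 ler_expR oppr_le0 divr_ge0. Qed.
Let tb : t ^+ 2 = expR (- b).
Proof. by rewrite /t -expRM_natl; congr expR; field. Qed.
Let p_ge0 : 0 <= p. Proof. by rewrite divr_ge0 // ltW. Qed.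
Let p_le1 : p <= 1. Proof. by rewrite ler_pdivrMr// mul1r. Qed.
Let L0 : 0 <= L. Proof. exact: lipc_ge0. Qed.
Let LE : 1 + L = expR b.
Proof. by rewrite /L /lipc tb expRN; field; rewrite gt_eqF ?expR_gt0. Qed.

(** Since 1 + L = e^b, e^(2b) - 1 = L (2 + L) >= 2 L, and the exponential in [Cbg] is at least 1, so
    14 L (c + c^3) < 1. The second bound uses 2 c^2 <= c + c^3. *)
Lemma small_coupling : L * c <= 1 / 14 /\ L * c ^+ 2 <= 1 / 28.
Proof.
have e2b : expR (2 * b) - 1 = L * (2 + L).
  by rewrite expRM_natl -LE; ring.
have x0 : 0 <= L * (2 + L) by rewrite mulr_ge0// addr_ge0.
have ex : 1 <= expR (c * (L * (2 + L))) by rewrite -[X in X <= _]expR0 ler_expR mulr_ge0.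
have cc : 0 <= c + c ^+ 3 by rewrite addr_ge0// exprn_ge0.
have := C_lt1; rewrite /Cbg e2b => C1.
have C2 : 7 * (c + c ^+ 3) * (L * (2 + L)) < 1.
  by apply: le_lt_trans C1; rewrite ler_peMr// mulr_ge0// mulr_ge0.
have C3 : 7 * (c + c ^+ 3) * (2 * L) < 1.
  apply: le_lt_trans C2; rewrite ler_wpM2l ?mulr_ge0// mulrC ler_wpM2l//.
  by rewrite lerDl.
have c3 : 0 <= c ^+ 3 * L by rewrite mulr_ge0// exprn_ge0.
split; first by move: C3; lra.
have : 0 <= c * (1 - c) ^+ 2 * L by apply: mulr_ge0 => //; apply: mulr_ge0 => //; exact: sqr_ge0.
by move: C3; lra.
Qed.

Let Lc := small_coupling.1.
Let Lc2 := small_coupling.2.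

(** A list of the wrong length gets the value of [f] at the all-false tuple, so the bounds by
    [fmin], [fmax] and [supnorm] hold for every list. *)
Definition seqfun (s : seq bool) : R := f (insubd (fdefault k) s).

Lemma seqfunE (s : k.-tuple bool) : seqfun s = f s.
Proof. by rewrite /seqfun valKd. Qed.

Lemma supnorm_ge0 : 0 <= M.
Proof. by apply: le_trans (le_bigmax _ _ (fdefault k)); exact: normr_ge0. Qed.

Lemma normr_seqfun s : `|seqfun s| <= M.
Proof. exact: (le_bigmax _ (fun s => `|f s|)). Qed.

Lemma seqfun_bounds s : fmin f <= seqfun s <= fmax f.
Proof. by rewrite /fmin /fmax bigmin_le le_bigmax. Qed.

Definition gf (x : seq R) : R := g (seqE x seqfun).

Lemma lips_gf : lips (nseq k (2 * M * Lg)) gf.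
Proof.
move=> x y; rewrite size_nseq => /andP[/eqP sx x01] /andP[/eqP sy y01].
have bd z : all (@in01 R) z -> fmin f <= seqE z seqfun <= fmax f.
  by move=> z01; apply: seqE_bounds => // s _; exact: seqfun_bounds.
apply: le_trans (g_lip (bd _ x01) (bd _ y01)) _.
have -> : nseq k (2 * M * Lg) = map ( *%R Lg) (nseq k (2 * M)) by rewrite map_nseq mulrC.
rewrite wdistZ ler_wpM2l// -[X in nseq X _]sx; apply: seqE_lip => //; first by rewrite sx.
by move=> s _; exact: normr_seqfun.
Qed.

Lemma iint_gf : iint nu (fun x : k.-tuple R => (g (prodE x f))%:E) = (rint nu k gf)%:E.
Proof.
have := iint_rint fp.1 lips_gf; rewrite size_nseq => <-; congr iint; apply/funext => x.
rewrite /gf -prodE_seqE; congr (g _)%:E; congr prodE; apply/funext => s.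
by rewrite seqfunE.
Qed.

Let vs : seq 'I_N := map (widen_ord Hk) (enum 'I_k).

Let size_vs : size vs = k. Proof. by rewrite size_map size_enum_ord. Qed.
Let uniq_vs : uniq vs.
Proof. by rewrite map_inj_uniq ?enum_uniq// => i j /(congr1 val) /= /val_inj. Qed.
Let sub_vs : {subset vs <= V}. Proof. by move=> w _; rewrite mem_enum. Qed.

Lemma actV : act h V = fun _ : 'I_N => expR h.
Proof. by apply/funext => w; rewrite /act mem_enum. Qed.

Lemma firstkE (s : N.-tuple bool) : f (firstk Hk s) = seqfun (map (finfun (tnth s)) vs).
Proof.
rewrite -seqfunE; congr seqfun; rewrite -map_comp -val_ord_tuple.
by apply: eq_map => i /=; rewrite ffunE.
Qed.

Lemma Einfl_pairs (l : seq 'I_N) : {subset l <= V} ->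
  E (fun G => infl_pairs t (adj G) N V l) <= (size l)%:R ^+ 2 * (2 * L * p).
Proof.
have LpN : L * (p * N%:R) <= 1 / 2 by rewrite /p divfK ?gt_eqF// (le_trans Lc)//; lra.
have x0 : 0 <= 2 * L * p by apply: mulr_ge0 => //; apply: mulr_ge0.
elim: l => [|u l IH] sub /=; first by rewrite Egraph_cst expr0n mul0r.
have sub' : {subset l <= V} by move=> w wl; apply: sub; rewrite inE wl orbT.
rewrite EgraphD Egraph_sum.
have h1 : \sum_(v <- l) E (fun G => infl t (adj G) N V v u) <= (size l)%:R * (2 * L * p).
  apply: sumr_le_const => // v vl.
  exact: (@Einfl _ _ c t t_gt0 t_le1 p_ge0 LpN N V v u (enum_uniq _) (sub' _ vl)).
apply: (le_trans (lerD h1 (IH sub'))); rewrite -mulrDl ler_wpM2r// -[(size l).+1%:R]nat1r.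
by have : 0 <= (size l)%:R :> R by []; lra.
Qed.

Lemma gibbs_vs_product :
  `|E (fun G => g (gibbs b h G (fun s => f (firstk Hk s)))) - E (fun G => gf (map (marg G) vs))|
    <= Lg * (4 * M) * (k%:R ^+ 2 * (2 * L * p)).
Proof.
rewrite -EgraphN -EgraphD; apply: le_trans (le_normr_Egraph p_ge0 p_le1 _) _.
have LM : 0 <= Lg * (4 * M) by rewrite !mulr_ge0// supnorm_ge0.
have := ler_wpM2l LM (Einfl_pairs sub_vs); rewrite size_vs -EgraphZ; apply: le_trans.
apply: le_Egraph => // G.
have e1 s : f (firstk Hk s) = (fun s' : {ffun 'I_N -> bool} => seqfun (map s' vs)) (finfun (tnth s)).
  exact: firstkE.
have gb : fmin f <= gibbs b h G (fun s => f (firstk Hk s)) <= fmax f.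
  by apply: gibbs_bounds => s; rewrite -seqfunE; exact: seqfun_bounds.
have pb : fmin f <= seqE (map (marg G) vs) seqfun <= fmax f.
  apply: seqE_bounds => [|s _]; last exact: seqfun_bounds.
  by apply/allP => _ /mapP[w _ ->]; exact: marg01.
apply: le_trans (g_lip gb pb) _; rewrite -mulrA ler_wpM2l//.
have -> : gibbs b h G (fun s => f (firstk Hk s)) =
    avg t (adj G) (act h V) (fun s => seqfun (map s vs)).
  by rewrite actV; exact: gibbs_avg.
apply: (avg_chain t_gt0 t_le1 (adjC G) (adjI G)) => //.
- by rewrite size_enum_ord.
- exact: enum_uniq.
- exact: act_ge0.
- exact: act_notin.
by move=> s _; exact: normr_seqfun.
Qed.

Lemma product_vs_rint :
  `|E (fun G => gf (map (marg G) vs)) - rint nu k gf| <= 2 * M * Lg * (budget L c K k%:R 0 0 / N%:R).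
Proof.
have a0 : 0 <= 2 * M * Lg by rewrite !mulr_ge0// supnorm_ge0.
have H F : lips (nseq k (2 * M * Lg)) F ->
    rint nu k F <= E (fun G => F (map (marg G) vs)) + 2 * M * Lg * (budget L c K k%:R 0 0 / N%:R).
  move=> hF; have := @lower_bound_all _ nu b h c t N t_gt0 t_le1 tb c_ge0 N_gt0 c_le Lc Lc2 fp
    N V [::] vs (2 * M * Lg) F (enum_uniq _) (size_enum_ord N) uniq_vs sub_vs a0.
  by rewrite /= size_vs subnn; apply.
have hN : lips (nseq k (2 * M * Lg)) (fun x => -1 * gf x).
  move=> x y cx cy; rewrite -mulrBr normrM normrN1 mul1r; exact: lips_gf.
have h1 := H _ lips_gf; have h2 := H _ hN.
have e : rint nu k (fun x => -1 * gf x) = -1 * rint nu k gf.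
  by have := rintZ fp.1 (-1) lips_gf; rewrite size_nseq.
rewrite e EgraphZ in h2.
by rewrite ler_norml; move: h1 h2; set X := E _; set Y := rint _ _ _; lra.
Qed.

(** The constant is 25 = 1 + 24: the product approximation costs 8 L c <= 1, and 24 = 2 * 3 * 4
    comes from [lips_gf], [budget_start] and [K]. The last two also give (1 + c)^4, and [K] gives 1
    + L = e^b. The errors are of order k^2 / N, at most k^3 / N. *)
Lemma local_limit :
  `|E (fun G => g (gibbs b h G (fun s => f (firstk Hk s)))) - rint nu k gf|
    <= 25 * (1 + c) ^+ 4 * expR b * (M * Lg * (k ^ 3)%:R / N%:R).
Proof.
apply: le_trans (ler_distD (E (fun G => gf (map (marg G) vs))) _ _) _.
apply: le_trans (lerD gibbs_vs_product product_vs_rint) _.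
have k1 : 1 <= k%:R :> R by rewrite ler1n.
have K0 : 0 <= K by rewrite /K !mulr_ge0 ?sqr_ge0// addr_ge0.
have B := budget_start L0 c_ge0 Lc K0 k1.
rewrite /K LE in B.
have MLg : 0 <= M * Lg by rewrite mulr_ge0// supnorm_ge0.
have kk : k%:R ^+ 2 <= (k ^ 3)%:R :> R.
  by rewrite -natrX ler_nat leq_pexp2l.
set D := (1 + c) ^+ 4 * expR b.
have D1 : 1 <= D.
  have b1 : 1 <= expR b by rewrite -LE lerDl.
  by apply: mulr_ege1 => //; apply: exprn_ege1; rewrite lerDl.
have X0 : 0 <= M * Lg * k%:R ^+ 2 / N%:R by rewrite divr_ge0 ?(ltW N0)// mulr_ge0// sqr_ge0.
have s1 : Lg * (4 * M) * (k%:R ^+ 2 * (2 * L * p)) <= D * (M * Lg * k%:R ^+ 2 / N%:R).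
  rewrite [X in X <= _](_ : _ = 8 * (L * c) * (M * Lg * k%:R ^+ 2 / N%:R)); last by rewrite /p; ring.
  by rewrite ler_wpM2r// (le_trans _ D1)//; move: Lc; lra.
have s2 : 2 * M * Lg * (budget L c K k%:R 0 0 / N%:R) <= 24 * D * (M * Lg * k%:R ^+ 2 / N%:R).
  apply: (@le_trans _ _ (2 * M * Lg * (3 * (4 * (1 + c) ^+ 2 * expR b) * (1 + c) ^+ 2 * k%:R ^+ 2 / N%:R))).
    rewrite /K LE ler_wpM2l//; first by rewrite -mulrA mulr_ge0.
    by rewrite ler_wpM2r// invr_ge0 ltW.
  by rewrite le_eqVlt; apply/orP; left; apply/eqP; rewrite /D; ring.
apply: (le_trans (lerD s1 s2)).
apply: (@le_trans _ _ (25 * D * (M * Lg * k%:R ^+ 2 / N%:R))); first by lra.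
rewrite -[25 * _ * expR b]mulrA -/D ler_wpM2l//; first by rewrite mulr_ge0// (le_trans _ D1).
by rewrite ler_wpM2r ?invr_ge0 ?(ltW N0)// ler_wpM2l.
Qed.

End LocalLimit.

Local Open Scope classical_set_scope.

Theorem mainTheorem3 (R : realType) :
  exists alpha : R -> R -> \bar R,
    (forall b b' c : R, 0 <= b -> b <= b' -> 0 <= c -> (alpha b c <= alpha b' c)%E) /\
    (forall b c c' : R, 0 <= b -> 0 <= c -> c <= c' -> (alpha b c <= alpha b c')%E) /\
    (forall b c : R, 0 <= b -> 0 <= c -> Cbg b c < 1 -> alpha b c \is a fin_num) /\
    (forall (beta h gamma : R) (nu : probability R R),
      0 <= beta -> 0 <= h -> 0 <= gamma -> Cbg beta gamma < 1 ->
      is_T_fixpoint beta h gamma nu ->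
      forall (k N : nat) (Hk : (k <= N)%N), gamma <= N%:R ->
      forall (f : k.-tuple bool -> R) (g : R -> R) (Lg : R),
        0 <= Lg -> lipschitz_itv g Lg (fmin f) (fmax f) ->
        (`| (Egraph gamma (fun G => g (gibbs beta h G (fun s => f (firstk Hk s)))))%:E
            - iint nu (fun x : k.-tuple R => (g (prodE x f))%:E) |
         <= alpha beta gamma * (supnorm f * Lg * (k ^ 3)%:R / N%:R)%:E)%E).
Proof.
exists (fun b c => (25 * (1 + c) ^+ 4 * expR b)%:E); split; [|split; [|split]].
- move=> b b' c b0 bb c0; rewrite lee_fin ler_wpM2l ?ler_expR//.
  by rewrite mulr_ge0// exprn_ge0// addr_ge0.
- move=> b c c' b0 c0 cc; rewrite lee_fin ler_wpM2r ?expR_ge0// ler_wpM2l//.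
  by rewrite lerXn2r ?nnegrE ?lerD2l// addr_ge0// (le_trans c0).
- by [].
move=> beta h gamma nu b0 _ c0 C1 fp [|k] N Hk cN f g Lg Lg0 glip; last first.
  rewrite (iint_gf fp Lg0 glip) -EFinB -EFinM abse_EFin lee_fin.
  exact: (local_limit Hk b0 c0 C1 cN (ltn0Sn k) fp Lg0 glip).
(* For [k = 0], where [N] may be 0, [f] has a single value: both expectations equal [g a], and the
   right side vanishes with [k ^ 3]. *)
pose a := f [tuple].
have fE : f = fun=> a by apply/funext => s; rewrite (tuple0 s).
have -> : Egraph gamma (fun G => g (gibbs beta h G (fun s => f (firstk Hk s)))) = g a.
  rewrite -[RHS](@Egraph_cst _ N gamma); congr Egraph; apply/funext => G; congr g.
  have /andP[h1 h2] : a <= gibbs beta h G (fun s => f (firstk Hk s)) <= a.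
    by apply: gibbs_bounds => s; rewrite fE lexx.
  by apply/eqP; rewrite eq_le h1 h2.
have -> : iint nu (fun x : 0.-tuple R => (g (prodE x f))%:E) = (g a)%:E.
  by rewrite /= -[f]/(fun s => f s) fE (prodE_seqE [tuple] (fun=> a)).
by rewrite subee// abse0 exp0n// mulr0 mul0r mule0.
Qed.
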